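(* Fix $\Delta\ge 1$ and $\rho\in(0,1)$. Then there exists a constant $\varepsilon=\varepsilon_{\Delta,\rho}>0$ (depending only on $\Delta$ and $\rho$) such that every finite graph $G=(V_G,E_G)$ satisfies at least one of the following three conditions: (i) $\displaystyle\sum_{x\in V_G}\deg_G(x)\log \deg_G(x) > (\Delta\log \Delta)\,|V_G|$; (ii) $\mathrm{card}\{i\colon \lambda_i(G)>\rho\}\ \ge\ \varepsilon|V_G|$; (iii) $\mathrm{card}\{e\in E_G\colon \kappa_G(e)<-\varepsilon\}\ \ge\ \varepsilon|E_G|$.
   Context: Graphs are simple and undirected. $\deg_G(x)$ is the degree of the vertex $x$, and $0\log 0:=0$. $\mathrm d_G(x,y)$ is the length of a shortest path from $x$ to $y$ in $G$. The transition matrix $P_G\colon V_G\times V_G\to[0,1]$ of the lazy simple random walk on $G$ is $P_G(x,y)=\frac{1}{2\deg_G(x)}$ if $\{x,y\}\in E_G$, $P_G(x,x)=\frac12$, and $P_G(x,y)=0$ otherwise; if $x$ is an isolated vertex, $P_G(x,x):=1$. If $N=|V_G|$, the matrix $P_G$ has $N$ real eigenvalues (with multiplicity) $1=\lambda_1(G)\ge\lambda_2(G)\ge\dots\ge\lambda_N(G)\ge 0$. The Ollivier-Ricci curvature at an edge $e=\{x,y\}\in E_G$ is $\kappa_G(e)=\kappa_G(x,y):=1-\mathcal W_1(P_G(x,\cdot),P_G(y,\cdot))$, where $\mathcal W_1$ is the $L^1$-Wasserstein distance for the metric $\mathrm d_G$: $\mathcal W_1(P_G(x,\cdot),P_G(y,\cdot))=\inf_\pi\sum_{u,v}\pi(u,v)\,\mathrm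 d_G(u,v)$, the infimum being over all probability distributions $\pi$ on pairs of vertices with marginals $P_G(x,\cdot)$ and $P_G(y,\cdot)$ (all vertices involved lie in the connected component of $x$ and $y$). *)

(* Defs.v *)
From mathcomp Require Import all_boot all_order all_algebra.
From mathcomp Require Import polyrcf complex.
From mathcomp Require Import ring.
From mathcomp Require Import boolp classical_sets reals exp.

Set Implicit Arguments.
Unset Strict Implicit.
Unset Printing Implicit Defensive.

Import Order.TTheory GRing.Theory Num.Theory.
Local Open Scope ring_scope.

Record sgraph := SGraph {
  vertex :> finType;
  adj : rel vertex;
  adj_sym : symmetric adj;
  adj_irr : irreflexive adj
}.

Section Graph.
Variable G : sgraph.
Implicit Types x y : G.

Definition deg x : nat := #|[set y | adj x y]|.

Definition edges : {set {set G}} :=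
  [set [set p.1; p.2] | p in [set p : G * G | adj p.1 p.2]].

Definition is_path_between x y (p : seq G) : bool :=
  [&& path (@adj G) x p, last x p == y & uniq (x :: p)].

(* Value #|G| if x and y are not connected; such pairs carry no mass in the
   couplings below. *)
Definition gdist x y : nat :=
  find (fun k => [exists p : k.-tuple G, is_path_between x y p]) (iota 0 #|G|).

Lemma gdistP x y (p : seq G) : is_path_between x y p ->
  (gdist x y <= size p)%N /\
  exists2 q, is_path_between x y q & size q = gdist x y.
Proof.
move=> pP; have /and3P[_ _ up] := pP.
have ltp : (size p < #|G|)%N.
  by rewrite -[(size p).+1]/(size (x :: p)) -(card_uniqP up) max_card.
set a := fun k => [exists q : k.-tuple G, is_path_between x y q].
have ap : a (size p) by apply/existsP; exists (in_tuple p).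
have ha : has a (iota 0 #|G|).
  by apply/hasP; exists (size p); rewrite // mem_iota.
split.
  rewrite leqNgt; apply/negP => /(before_find 0%N).
  by rewrite nth_iota // add0n => H; have := ap; rewrite /a H.
have := nth_find 0%N ha; rewrite nth_iota ?add0n; last first.
  by rewrite -[X in (_ < X)%N](size_iota 0) -has_find.
by case/existsP => q qP; exists q; rewrite ?size_tuple.
Qed.

Lemma is_path_between_rev x y p :
  is_path_between x y p -> is_path_between y x (rev (belast x p)).
Proof.
case/and3P => pp /eqP <- up; rewrite /is_path_between.
have -> : last x p :: rev (belast x p) = rev (x :: p).
  by rewrite [x :: p]lastI rev_rcons.
rewrite rev_uniq up rev_path.
rewrite (eq_path (e' := @adj G)); last by move=> a b; rewrite adj_sym.
rewrite pp andbT /=; case: p {pp up} => //= a p.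
by rewrite rev_cons last_rcons.
Qed.

Lemma gdistC x y : gdist x y = gdist y x.
Proof.
apply: eq_find => k; apply/existsP/existsP => -[q /is_path_between_rev qP].
  by exists (rev_tuple (belast_tuple x q)).
by exists (rev_tuple (belast_tuple y q)).
Qed.

Variable R : realType.

Definition lazy_walk x y : R :=
  if deg x == 0%N then (x == y)%:R
  else if x == y then 2^-1
  else if adj x y then (2 * (deg x)%:R)^-1
  else 0.

Definition coupling (mu nu : G -> R) (pi : G -> G -> R) : Prop :=
  [/\ forall u v, 0 <= pi u v,
      forall u, \sum_v pi u v = mu u &
      forall v, \sum_u pi u v = nu v].

Definition wasserstein1 (mu nu : G -> R) : R :=
  inf [set c | exists2 pi, coupling mu nu pi
                         & c = \sum_u \sum_v pi u v * (gdist u v)%:R]%classic.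

Definition curvature x y : R := 1 - wasserstein1 (lazy_walk x) (lazy_walk y).

Lemma wasserstein1C mu nu : wasserstein1 mu nu = wasserstein1 nu mu.
Proof.
have sub (m n : G -> R) : ([set c | exists2 pi, coupling m n pi
    & c = \sum_u \sum_v pi u v * (gdist u v)%:R] `<=`
    [set c | exists2 pi, coupling n m pi
    & c = \sum_u \sum_v pi u v * (gdist u v)%:R])%classic.
  move=> _ [pi [pi0 pi1 pi2] ->]; exists (fun u v => pi v u); first by split.
  rewrite exchange_big; apply: eq_bigr => u _; apply: eq_bigr => v _.
  by rewrite gdistC.
by congr inf; apply/seteqP; split; apply: sub.
Qed.

Lemma curvatureC x y : curvature x y = curvature y x.
Proof. by rewrite /curvature wasserstein1C. Qed.

(* The edges e = {x,y} with curvature < c; by curvatureC the choice of the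
   ordering of the endpoints is immaterial. *)
Definition edges_curv_lt (c : R) : {set {set G}} :=
  [set [set p.1; p.2] | p in [set p : G * G | adj p.1 p.2
                                            & curvature p.1 p.2 < c]].

Definition transition_mx : 'M[R]_#|G| :=
  \matrix_(i, j) lazy_walk (enum_val i) (enum_val j).

End Graph.

(* All real eigenvalues, each repeated according to its algebraic multiplicity,
   in nonincreasing order. *)
Definition eigenvalues (R : rcfType) n (A : 'M[R]_n) : seq R :=
  sort >=%R (flatten [seq nseq (mup a (char_poly A)) a
                     | a <- rootsR (char_poly A)]).

(* Indices are shifted by one: [eigval R i] is the (i+1)-st largest one. *)
Definition eigval (G : sgraph) (R : realType) (i : 'I_#|G|) : R :=
  (eigenvalues (transition_mx G R))`_i.

Section Spectrum.
Variable R : rcfType.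

Lemma eigenvalues_perm n (A : 'M[R]_n) (s : seq R) :
  char_poly A = \prod_(a <- s) ('X - a%:P) -> perm_eq (eigenvalues A) s.
Proof.
move=> As; rewrite /eigenvalues perm_sort.
apply/allP => /= x _; apply/eqP.
have A0 : char_poly A != 0 by rewrite monic_neq0 // char_poly_monic.
rewrite count_flatten -map_comp.
have -> : [seq (count_mem x \o (fun a => nseq (mup a (char_poly A)) a)) a
    | a <- rootsR (char_poly A)] =
    [seq if a == x then count_mem x s else 0%N | a <- rootsR (char_poly A)].
  apply: eq_map => a /=; rewrite count_nseq /= As mu_prod_XsubC.
  by case: eqVneq => [->|_]; rewrite ?mul1n ?mul0n.
have ux : uniq (rootsR (char_poly A)) by exact: uniq_roots.
have xr : (x \in rootsR (char_poly A)) = (x \in s).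
  by rewrite -(roots_on_rootsR A0) /= As root_prod_XsubC.
rewrite -[LHS]/(sumn _) sumnE big_map -big_mkcond /= big_const_seq iter_addn_0.
have -> : count (eq_op^~ x) (rootsR (char_poly A)) = (x \in s).
  by rewrite -xr -count_uniq_mem.
by case: (boolP (x \in s)) => [_|/count_memPn ->]; rewrite ?muln1 ?muln0.
Qed.

Lemma char_poly_conj (K : comUnitRingType) n (D A : 'M[K]_n) : D \in unitmx ->
  char_poly (D *m A *m invmx D) = char_poly A.
Proof.
move=> Du; pose D1 := map_mx polyC D; pose D2 := map_mx polyC (invmx D).
have DD : D1 *m D2 = 1%:M by rewrite -map_mxM mulmxV // map_mx1.
rewrite /char_poly.
have -> : char_poly_mx (D *m A *m invmx D) = D1 *m char_poly_mx A *m D2.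
  rewrite /char_poly_mx !map_mxM mulmxBr mulmxBl; congr (_ - _).
  by rewrite scalar_mxC -mulmxA DD mulmx1.
by rewrite !det_mulmx mulrAC -det_mulmx DD det1 mul1r.
Qed.

Lemma sym_char_poly_split n (A : 'M[R]_n) : A^T = A ->
  exists s : 'I_n -> R, char_poly A = \prod_i ('X - (s i)%:P).
Proof.
move=> At; pose C := R[i]; pose f := real_complex R.
pose B : 'M[C]_n := map_mx f A.
have Breal : B \is a realmx.
  by apply/mxOverP => i j; rewrite mxE; apply/complex_realP; exists (A i j).
have Bherm : B \is hermsymmx.
  apply: realsym_hermsym => //; apply/is_hermitianmxP.
  by rewrite expr0 scale1r map_mx_id // /B map_trmx At.
have /orthomx_spectralP Beq := hermitian_normalmx Bherm.
have /mxOverP dreal := hermitian_spectral_diag_real Bherm.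
pose d := spectral_diag B.
exists (fun i => complex.Re (d 0 i)).
apply: (map_poly_inj f); rewrite map_char_poly -/B Beq.
have Uu := spectral_unit B.
rewrite -{2}[spectralmx B]invmxK char_poly_conj ?unitmx_inv //.
rewrite char_poly_trig ?diag_mx_is_trig // rmorph_prod; apply: eq_bigr => i _.
rewrite mxE eqxx mulr1n rmorphB /= map_polyX map_polyC; congr (_ - _%:P).
by have /complex_realP[k ->] := dreal 0 i.
Qed.

End Spectrum.

Section GraphSpectrum.
Variables (R : realType) (G : sgraph).

Lemma transition_mx_char_poly :
  char_poly (transition_mx G R) = \prod_(i < #|G|) ('X - (eigval R i)%:P).
Proof.
pose w (i : 'I_#|G|) : R := Num.sqrt (maxn 1 (deg (enum_val i)))%:R.
have w_gt0 i : 0 < w i by rewrite sqrtr_gt0 ltr0n leq_max.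
pose D := diag_mx (\row_i w i).
pose D' := diag_mx (\row_i (w i)^-1).
have DD' : D *m D' = 1%:M.
  rewrite mulmx_diag -diag_const_mx; congr diag_mx.
  by apply/rowP => i; rewrite !mxE divff ?gt_eqF.
have [Du invD] := mulmx1_unit DD'.
have {invD} D'E : D' = invmx D.
  by rewrite -[D']mul1mx -(mulVmx Du) -mulmxA DD' mulmx1.
have adjd (x y : G) : adj x y -> (0 < deg x)%N.
  by move=> xy; apply/card_gt0P; exists y; rewrite inE.
have Ssym : (D *m transition_mx G R *m D')^T = D *m transition_mx G R *m D'.
  apply/matrixP => i j.
  rewrite mxE !mul_mx_diag !mul_diag_mx !mxE.
  case: (eqVneq i j) => [->//|ij].
  rewrite /lazy_walk !(inj_eq enum_val_inj) (eq_sym j i) !(negPf ij).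
  set x := enum_val i; set y := enum_val j.
  rewrite [adj y x]adj_sym; case: (boolP (adj x y)) => [xy|_]; last first.
    by rewrite !if_same !mulr0 !mul0r.
  have dx := adjd _ _ xy.
  have dy : (0 < deg y)%N by rewrite (adjd y x) // adj_sym.
  rewrite !gtn_eqF //.
  have wsq k : (0 < deg (enum_val k))%N -> (deg (enum_val k))%:R = w k ^+ 2.
    by move=> dk; rewrite sqr_sqrtr ?ler0n // (maxn_idPr dk).
  rewrite !wsq // !invfM.
  have wi := gt_eqF (w_gt0 i); have wj := gt_eqF (w_gt0 j).
  by field; rewrite wi wj.
have [s sE] := sym_char_poly_split Ssym.
rewrite D'E char_poly_conj // in sE.
have sE' : char_poly (transition_mx G R) =
    \prod_(a <- [seq s i | i <- enum 'I_#|G|]) ('X - a%:P).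
  by rewrite sE big_map big_enum.
have ps := eigenvalues_perm sE'.
have sz : size (eigenvalues (transition_mx G R)) = #|G|.
  by rewrite (perm_size ps) size_map size_enum_ord.
by rewrite sE' -(perm_big _ ps) (big_nth 0) sz big_mkord.
Qed.

End GraphSpectrum.

(* Main.v *)
(* Write m(x) = max(1, deg x), a reversible measure for the walk P, and suppose
   that (i), (ii) and (iii) all fail.

   Failure of (i) makes the degrees uniformly integrable, so that small sets
   of vertices have small mass, and so do their neighbourhoods of bounded
   radius.  Hence most vertices x are good: around x, up to a fixed radius, the
   degrees are bounded and no edge has curvature < - eps.

   Couple the walks started at the ends of an edge near a good vertex.  By
   almost nonnegative curvature their distance d is almost a supermartingale,
   and laziness allows one to modify the coupling so that d drops with
   probability at least 1 / (2 deg).  Then the bounded, strictly concave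
   function 1 - 2^-d of the distance loses a fixed amount in mean whenever d is
   bounded and nonzero and the degree is bounded; so the mean over t < S of the
   total variation distance between P^t(x, .) and P^t(y, .) is small for S
   large.

   Consequently the functions x |-> sqrt (m x P^t(x, z)), cut off outside the
   good vertices, have a total Dirichlet form which is a small fraction of
   their total squared norm.  On the other hand their Gram matrix has bounded
   norm, because only boundedly many good vertices x satisfy P^t(x, z) <> 0; so
   they cannot concentrate on the fewer than eps |V| eigenvectors of eigenvalue
   > rho, and their Dirichlet form is at least about 1 - rho times their
   squared norm. *)

Require Import Defs.
From mathcomp Require Import all_boot all_order all_algebra.
From mathcomp Require Import reals exp.
From mathcomp Require Import complex zify ring lra.
From mathcomp Require Import boolp classical_sets sequences.

Set Implicit Arguments.
Unset Strict Implicit.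
Unset Printing Implicit Defensive.

Import Order.TTheory GRing.Theory Num.Theory.
Local Open Scope ring_scope.

(** * Graph distance and geodesics *)

Section Distance.
Variable G : sgraph.
Implicit Types x y z : G.

(** [gdist] ranges over simple paths only; a walk is first shortened to a simple path with the same
    ends. *)
Lemma gdist_le_size x p : path (@adj G) x p -> (gdist x (last x p) <= size p)%N.
Proof.
move=> xp; case: (shortenP xp) => q xq uq qp.
have /gdistP[le_q _] : is_path_between x (last x q) q.
  by rewrite /is_path_between xq eqxx uq.
apply: leq_trans le_q (uniq_leq_size _ qp).
by case/andP: uq.
Qed.

Lemma connect_geodesic x y : connect (@adj G) x y ->
  exists p, [/\ path (@adj G) x p, last x p = y & size p = gdist x y].
Proof.
case/connectP=> p xp yE; case: (shortenP xp) yE => q xq uq _ yE.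
have /gdistP[_ [r /and3P[xr /eqP yr _] sr]] : is_path_between x y q.
  by rewrite /is_path_between xq yE eqxx uq.
by exists r.
Qed.

Lemma gdist_le_card x y : (gdist x y <= #|G|)%N.
Proof. by rewrite -[X in (_ <= X)%N](size_iota 0) find_size. Qed.

Lemma gdist_nconnect x y : ~~ connect (@adj G) x y -> gdist x y = #|G|.
Proof.
move=> nxy; rewrite /gdist -[RHS](size_iota 0); apply/eqP.
rewrite eqn_leq find_size leqNgt -has_find; apply/negP => /hasP[k _].
case/existsP => p /and3P[xp /eqP yE _].
by case/negP: nxy; apply/connectP; exists p.
Qed.

Lemma gdistxx x : gdist x x = 0%N.
Proof. by apply/eqP; rewrite -leqn0; exact: (gdist_le_size (p := [::])). Qed.

Lemma gdist_adj x y : adj x y -> (gdist x y <= 1)%N.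
Proof. by move=> xy; apply: (gdist_le_size (p := [:: y])); rewrite /= xy. Qed.

(** This includes disconnected pairs: their default value [#|G|] bounds every distance, so such a
    pair on the right already pays for the left. *)
Lemma gdist_triangle x y z : (gdist x z <= gdist x y + gdist y z)%N.
Proof.
case: (boolP (connect (@adj G) x y)) => [/connect_geodesic[p [xp <- <-]]|nxy].
  case: (boolP (connect (@adj G) (last x p) z)).
    case/connect_geodesic => q [xq <- <-].
    by rewrite -last_cat -size_cat gdist_le_size // cat_path xp.
  by move/gdist_nconnect ->; rewrite (leq_trans (gdist_le_card _ _)) ?leq_addl.
by rewrite (gdist_nconnect nxy) (leq_trans (gdist_le_card _ _)) ?leq_addr.
Qed.

Lemma adj_deg_gt0 x y : adj x y -> (0 < deg x)%N.
Proof. by move=> xy; apply/card_gt0P; exists y; rewrite inE. Qed.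

End Distance.

(** * The lazy walk, its reversible measure, and couplings of one step *)

Section Walk.
Variables (R : realType) (G : sgraph).
Implicit Types (x y : G) (mu nu : G -> R) (pi : G -> G -> R).

Local Notation P := (@lazy_walk G R).

Lemma lazy_walk_ge0 x y : 0 <= P x y.
Proof.
rewrite /lazy_walk; case: eqP => _; first exact: ler0n.
case: eqP => _; first by rewrite invr_ge0 ler0n.
by case: ifP => // _; rewrite invr_ge0 mulr_ge0 ?ler0n.
Qed.

Lemma lazy_walk_support x y : P x y != 0 -> (x == y) || adj x y.
Proof.
rewrite /lazy_walk; case: (deg x == _).
  by case: (x == y) => //; rewrite eqxx.
by case: (x == y) => //; case: ifP => //; rewrite eqxx.
Qed.

Lemma sum_lazy_walk x : \sum_y P x y = 1.
Proof.
rewrite /lazy_walk; case: eqP => [_|/eqP dx].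
  rewrite (bigD1 x) //= eqxx big1 ?addr0 // => y /negPf.
  by rewrite eq_sym => ->.
rewrite (bigD1 x) //= eqxx.
rewrite (eq_bigr (fun y => if y \in [set y | adj x y] then
    (2 * (deg x)%:R)^-1 else 0)); last first.
  by move=> y /negPf; rewrite eq_sym => ->; rewrite inE.
rewrite -big_mkcondr (eq_bigl (fun y => y \in [set y | adj x y])).
  rewrite sumr_const -/(deg x) -mulr_natl.
  by field; rewrite pnatr_eq0.
move=> y; rewrite inE; case: eqP => [->|//]; by rewrite adj_irr.
Qed.

(* Isolated vertices have mass 1, so that the total mass is at least #|G|. *)
Definition mass x : R := (maxn 1 (deg x))%:R.

Lemma mass_ge1 x : 1 <= mass x.
Proof. by rewrite ler1n leq_max. Qed.

Lemma mass_gt0 x : 0 < mass x.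
Proof. exact: lt_le_trans ltr01 (mass_ge1 x). Qed.

Lemma lazy_walk_reversible x y : mass x * P x y = mass y * P y x.
Proof.
rewrite /mass /lazy_walk (eq_sym y x); case: (eqVneq x y) => [->//|_].
rewrite adj_sym; case: (boolP (adj y x)) => [|_]; last first.
  by rewrite !if_same !mulr0.
move=> yx; have dy := adj_deg_gt0 yx.
have dx : (0 < deg x)%N by rewrite (@adj_deg_gt0 _ _ y) // adj_sym.
rewrite !gtn_eqF // !(maxn_idPr _) //.
by field; rewrite !pnatr_eq0 -!lt0n dx dy.
Qed.

Lemma coupling_mass mu nu pi : coupling mu nu pi -> \sum_x mu x = 1 ->
  \sum_u \sum_v pi u v = 1.
Proof. by case=> _ h _ <-; apply: eq_bigr. Qed.

Lemma coupling_neq0 mu nu pi u v : coupling mu nu pi -> pi u v != 0 ->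
  mu u != 0 /\ nu v != 0.
Proof.
case=> pi0 pi1 pi2; have := pi0 u v; rewrite le0r => /orP[/eqP->|].
  by rewrite eqxx.
move=> piuv _; rewrite -pi1 -pi2; split; rewrite gt_eqF //.
  by rewrite (bigD1 v) //= ltr_pwDl // sumr_ge0.
by rewrite (bigD1 u) //= ltr_pwDl // sumr_ge0.
Qed.

Definition cost pi : R := \sum_u \sum_v pi u v * (gdist u v)%:R.

Lemma coupling_id mu : (forall u, 0 <= mu u) ->
  coupling mu mu (fun u v => mu u * (u == v)%:R) /\
  cost (fun u v => mu u * (u == v)%:R) = 0.
Proof.
move=> mu0; split; last first.
  rewrite /cost big1 // => u _; rewrite big1 // => v _.
  by case: eqP => [->|_]; rewrite ?gdistxx !(mulr0, mul0r).
split=> [u v|u|v]; first by rewrite mulr_ge0 ?ler0n.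
  rewrite (bigD1 u) //= eqxx mulr1 big1 ?addr0 // => v.
  by rewrite eq_sym => /negPf->; rewrite mulr0.
by rewrite (bigD1 v) //= eqxx mulr1 big1 ?addr0 // => u /negPf->; rewrite mulr0.
Qed.

(** Take [pi1] and [pi2] conditionally independent given the middle point v, apply the triangle
    inequality, and forget v. *)
Lemma coupling_glue mu nu xi pi1 pi2 :
  coupling mu nu pi1 -> coupling nu xi pi2 ->
  exists2 pi, coupling mu xi pi & cost pi <= cost pi1 + cost pi2.
Proof.
move=> c1 c2; have [p10 p11 p12] := c1; have [p20 p21 p22] := c2.
(* If [nu v] is 0, the quotient is 0 by convention; this is harmless, as [pi1 u v] and [pi2 v w]
   then vanish too. *)
have K1 u v : pi1 u v / nu v * nu v = pi1 u v.
  have [->|n0] := eqVneq (pi1 u v) 0; first by rewrite !mul0r.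
  by rewrite mulfVK //; case: (coupling_neq0 c1 n0).
have K2 v w : nu v / nu v * pi2 v w = pi2 v w.
  have [->|n0] := eqVneq (pi2 v w) 0; first by rewrite !mulr0.
  by rewrite divff ?mul1r //; case: (coupling_neq0 c2 n0).
have nu0 v : 0 <= nu v by rewrite -p12 sumr_ge0.
pose q u v w := pi1 u v / nu v * pi2 v w.
have q0 u v w : 0 <= q u v w by rewrite !mulr_ge0 ?invr_ge0.
have qw u v : \sum_w q u v w = pi1 u v by rewrite -mulr_sumr p21 K1.
have qu v w : \sum_u q u v w = pi2 v w.
  by rewrite -mulr_suml -mulr_suml p12 K2.
exists (fun u w => \sum_v q u v w).
  split=> [u w|u|w]; first by rewrite sumr_ge0.
    by rewrite exchange_big /= -p11; apply: eq_bigr.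
  by rewrite exchange_big /= -p22; apply: eq_bigr.
have -> : cost pi1 = \sum_u \sum_w \sum_v q u v w * (gdist u v)%:R.
  rewrite /cost; apply: eq_bigr => u _; rewrite exchange_big /=.
  by apply: eq_bigr => v _; rewrite -qw mulr_suml.
have -> : cost pi2 = \sum_u \sum_w \sum_v q u v w * (gdist v w)%:R.
  rewrite /cost exchange_big [RHS]exchange_big; apply: eq_bigr => w _ /=.
  by rewrite exchange_big; apply: eq_bigr => v _; rewrite -qu mulr_suml.
rewrite /cost -big_split; apply: ler_sum => u _ /=.
rewrite -big_split; apply: ler_sum => w _ /=.
rewrite -big_split mulr_suml; apply: ler_sum => v _ /=.
by rewrite -mulrDr -natrD ler_wpM2l // ler_nat gdist_triangle.
Qed.

(** Doubling eps leaves strict room above the infimum, which is at most 1 + eps, so that an actual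
    coupling fits in between. *)
Lemma curvature_coupling (eps : R) x y : 0 < eps -> - eps <= curvature R x y ->
  exists2 pi, coupling (P x) (P y) pi & cost pi <= 1 + 2 * eps.
Proof.
move=> eps0; rewrite /curvature => curv.
set A := [set c | exists2 pi, coupling (P x) (P y) pi & c = cost pi]%classic.
have A0 : (A !=set0)%classic.
  exists (cost (fun u v => P x u * P y v)), (fun u v => P x u * P y v) => //.
  split=> [u v|u|v]; first by rewrite mulr_ge0 ?lazy_walk_ge0.
    by rewrite -mulr_sumr sum_lazy_walk mulr1.
  by rewrite -mulr_suml sum_lazy_walk mul1r.
have /(inf_lt A0)[_ [pi cpi ->] /ltW] : inf A < 1 + 2 * eps; last by exists pi.
by move: curv eps0; rewrite /wasserstein1 -/A; lra.
Qed.

(** Path coupling: couplings along the edges are glued one after the other, and their costs add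
    up. *)
Lemma path_coupling (eps : R) (Q : pred G) x p :
  0 <= eps ->
  (forall u v, adj u v -> Q u ->
    exists2 pi, coupling (P u) (P v) pi & cost pi <= 1 + eps) ->
  path (@adj G) x p -> all Q (x :: p) ->
  exists2 pi, coupling (P x) (P (last x p)) pi
    & cost pi <= (size p)%:R * (1 + eps).
Proof.
move=> e0 step; elim: p x => [|y p IH] x /=.
  move=> _ _; have [c c0] := coupling_id (lazy_walk_ge0 x).
  by eexists; first exact: c; rewrite c0 mul0r.
case/andP=> xy yp /andP[Qx Qp].
have [pi1 c1 l1] := step _ _ xy Qx.
have [pi2 c2 l2] := IH _ yp Qp.
have [pi c l] := coupling_glue c1 c2.
exists pi => //; apply: le_trans l _.
by rewrite mulrSr mulrDl mul1r addrC lerD.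
Qed.

End Walk.

(** * Contraction of coupled walks and decay of total variation *)

Section Contraction.
Variables (R : realType) (G : sgraph).
Implicit Types (x y : G) (mu nu : G -> R) (pi : G -> G -> R).

Local Notation P := (@lazy_walk G R).

Lemma lazy_walkxx x : (0 < deg x)%N -> P x x = 2^-1.
Proof. by move=> dx; rewrite /lazy_walk eqxx gtn_eqF. Qed.

Lemma lazy_walk_adj x y : adj x y -> P x y = (2 * (deg x)%:R)^-1.
Proof.
move=> xy; rewrite /lazy_walk xy gtn_eqF ?(adj_deg_gt0 xy) //.
by case: eqVneq xy => [->|//]; rewrite adj_irr.
Qed.

(* The mass m which pi sends from a to the points v != y is at most pi x y,
   because P x x = P y y = 1/2.  Replacing a -> v and x -> y by a -> y and
   x -> v does not increase the cost: the loss in d x v <= 1 + d a v is paid by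
   d a y <= d x y - 1. *)
Lemma coupling_swap x y a pi : coupling (P x) (P y) pi ->
  adj x a -> (0 < deg y)%N -> (gdist a y < gdist x y)%N ->
  exists pi', [/\ coupling (P x) (P y) pi', cost pi' <= cost pi
    & pi' a y = (2 * (deg x)%:R)^-1].
Proof.
move=> cpi xa dy day; have [pi0 pi1 pi2] := cpi.
have dx := adj_deg_gt0 xa.
have nxa : a != x by apply: contraTneq xa => ->; rewrite adj_irr.
pose m := \sum_(v | v != y) pi a v.
have mE : pi a y + m = (2 * (deg x)%:R)^-1.
  by rewrite -(lazy_walk_adj xa) -pi1 [RHS](bigD1 y).
have m0 : 0 <= m by rewrite sumr_ge0.
(* Row x and column y each carry half of the total mass 1. Hence [pi x y] equals the mass off both
   of them, and m is part of that mass. *)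
have mxy : m <= pi x y.
  have tot := coupling_mass cpi (sum_lazy_walk R x).
  rewrite (bigD1 x) //= pi1 lazy_walkxx // in tot.
  have coly := pi2 y; rewrite (bigD1 x) //= lazy_walkxx // in coly.
  have split : \sum_(u | u != x) \sum_v pi u v =
      \sum_(u | u != x) pi u y + \sum_(u | u != x) \sum_(v | v != y) pi u v.
    by rewrite -big_split; apply: eq_bigr => u _; rewrite (bigD1 y).
  have mle : m <= \sum_(u | u != x) \sum_(v | v != y) pi u v.
    rewrite (bigD1 a) //= lerDl sumr_ge0 // => u _; exact: sumr_ge0.
  by lra.
(* The swap adds the rank-one term [e u * s v]; both factors sum to zero, so the marginals are
   kept. *)
pose s v := if v == y then m else - pi a v.
pose e u : R := (u == a)%:R - (u == x)%:R.
have s0 : \sum_v s v = 0.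
  rewrite (bigD1 y) //= {1}/s eqxx (eq_bigr (fun v => - pi a v)).
    by rewrite sumrN subrr.
  by move=> v /negPf; rewrite /s => ->.
have sum_e (f : G -> R) : \sum_u e u * f u = f a - f x.
  have ind b : \sum_u (u == b)%:R * f u = f b.
    rewrite (bigD1 b) //= eqxx mul1r big1 ?addr0 // => u /negPf->.
    by rewrite mul0r.
  by rewrite /e (eq_bigr _ (fun u _ => mulrBl _ _ _)) sumrB !ind.
exists (fun u v => pi u v + e u * s v); split; first split.
- move=> u v; rewrite /e /s.
  have [->|ua] := eqVneq u a.
    rewrite (negPf nxa) subr0 mul1r; case: eqVneq => [->|_].
      by rewrite addr_ge0.
    by rewrite subrr.
  rewrite sub0r; have [->|ux] := eqVneq u x; last by rewrite oppr0 mul0r addr0.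
  rewrite mulN1r; case: eqVneq => [->|_]; first by rewrite subr_ge0.
  by rewrite opprK addr_ge0.
- by move=> u; rewrite big_split /= -mulr_sumr s0 mulr0 addr0.
- by move=> v; rewrite big_split /= (sum_e (fun=> s v)) subrr addr0.
- rewrite /cost.
  have -> : \sum_u \sum_v (pi u v + e u * s v) * (gdist u v)%:R =
      cost pi + \sum_v s v * ((gdist a v)%:R - (gdist x v)%:R).
    rewrite [X in _ + X](_ : _ = \sum_v \sum_u e u * s v * (gdist u v)%:R).
      rewrite [X in _ + X]exchange_big -big_split; apply: eq_bigr => u _ /=.
      by rewrite -big_split; apply: eq_bigr => v _ /=; rewrite mulrDl.
    apply: eq_bigr => v _.
    rewrite (eq_bigr (fun u => e u * (s v * (gdist u v)%:R))).
      by rewrite (sum_e (fun u => s v * (gdist u v)%:R)) mulrBr.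
    by move=> u _; rewrite mulrA.
  rewrite gerDl -s0 -subr_le0.
  rewrite s0 subr0 (bigD1 y) //= {1}/s eqxx.
  apply: le_trans (_ : - m + m <= 0); last by rewrite addNr.
  apply: lerD.
    have : (gdist a y)%:R + 1 <= (gdist x y)%:R :> R by rewrite natr1 ler_nat.
    by move: m0; nra.
  rewrite /m; apply: ler_sum => v /negPf; rewrite /s => ->.
  rewrite mulNr -mulrN opprB ler_piMr // lerBlDr.
  rewrite -(natrD R 1) ler_nat.
  exact: leq_trans (gdist_triangle x a v) (leq_add (gdist_adj xa) _).
- by rewrite /e /s !eqxx (negPf nxa) subr0 mul1r mE.
Qed.

Fixpoint nbhd (A : {set G}) (r : nat) : {set G} :=
  if r is r'.+1 then
    [set x | (x \in nbhd A r') || [exists y in nbhd A r', adj x y]]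
  else A.

Lemma notin_nbhdS A r x y : x \notin nbhd A r.+1 -> (x == y) || adj x y ->
  y \notin nbhd A r.
Proof.
rewrite inE negb_or => /andP[xr /existsPn nx] /orP[/eqP <-//|xy].
by have := nx y; rewrite xy andbT.
Qed.

Lemma notin_nbhd_path A r x p : x \notin nbhd A r -> path (@adj G) x p ->
  (size p <= r)%N -> all (fun z => z \notin A) (x :: p).
Proof.
elim: r x p => [|r IH] x [|y p] //= xr.
- by rewrite xr.
- by move=> _ _; apply: (IH x [::]) => //; apply: notin_nbhdS xr _;
    rewrite eqxx.
case/andP=> xy yp sp; have yr : y \notin nbhd A r.
  by apply: notin_nbhdS xr _; rewrite xy orbT.
have xr' : x \notin nbhd A r by apply: notin_nbhdS xr _; rewrite eqxx.
by have /andP[-> _] := IH x [::] xr' isT isT; rewrite [_ && _](IH y p yr yp sp).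
Qed.

(** A geodesic from x of length at most r avoids A, so path coupling applies along it. The swap with
    its first step a then puts all of [P x a] on the strictly closer pair (a, y). *)
Lemma contraction_step (A : {set G}) (eps : R) r x y :
  0 <= eps ->
  (forall u v, adj u v -> u \notin A ->
    exists2 pi, coupling (P u) (P v) pi & cost pi <= 1 + eps) ->
  x \notin nbhd A r -> connect (@adj G) x y -> x != y -> (gdist x y <= r)%N ->
  exists pi a, [/\ coupling (P x) (P y) pi,
    cost pi <= (gdist x y)%:R * (1 + eps),
    (gdist a y < gdist x y)%N, (0 < deg x)%N &
    pi a y = (2 * (deg x)%:R)^-1].
Proof.
move=> e0 hA xr xy nxy dr.
have [p [xp yE sp]] := connect_geodesic xy.
have sr : (size p <= r)%N by rewrite sp.
have [pi0 c l] := path_coupling e0 hA xp (notin_nbhd_path xr xp sr).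
case: p xp yE sp sr c l => [_ /eqP|a p]; first by rewrite (negPf nxy).
move=> /andP[xa ap] yE sp _ c l.
have day : (gdist a y < gdist x y)%N.
  by rewrite -sp /= -yE ltnS; exact: gdist_le_size.
rewrite yE sp in c l.
have dy : (0 < deg y)%N.
  move: xy; rewrite (sym_connect_sym (@adj_sym G)) => /connectP[[|b q] /=].
    by move=> _ E; rewrite E eqxx in nxy.
  by case/andP=> /adj_deg_gt0.
have [pi [cp lp Ep]] := coupling_swap c xa dy day.
by exists pi, a; split=> //; [exact: le_trans lp l | exact: adj_deg_gt0 xa].
Qed.

(** This is P^n f, unfolded at the first step because that is the step to be coupled. *)
Fixpoint evol (n : nat) (f : G -> R) x : R :=
  if n is n'.+1 then \sum_w P x w * evol n' f w else f x.

Definition walk n x z : R := evol n (fun w => (w == z)%:R) x.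

Definition tv n x y : R := 2^-1 * \sum_z `|walk n x z - walk n y z|.

Lemma evol_ge0 n f x : (forall y, 0 <= f y) -> 0 <= evol n f x.
Proof.
move=> f0; elim: n x => [|n IH] x //=.
by apply: sumr_ge0 => w _; rewrite mulr_ge0 ?lazy_walk_ge0.
Qed.

Lemma walk_ge0 n x z : 0 <= walk n x z.
Proof. by apply: evol_ge0 => w; exact: ler0n. Qed.

Lemma sum_walk n x : \sum_z walk n x z = 1.
Proof.
rewrite /walk; elim: n x => [|n IH] x /=.
  rewrite (bigD1 x) //= eqxx big1 ?addr0 // => y /negPf.
  by rewrite eq_sym => ->.
rewrite exchange_big /= -[RHS](sum_lazy_walk R x).
by apply: eq_bigr => w _; rewrite -mulr_sumr IH mulr1.
Qed.

Lemma tvxx n x : tv n x x = 0.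
Proof. by rewrite /tv big1 ?mulr0 // => z _; rewrite subrr normr0. Qed.

Lemma tv_le1 n x y : tv n x y <= 1.
Proof.
rewrite /tv ler_pdivrMl // mulr1.
apply: le_trans (_ : \sum_z (walk n x z + walk n y z) <= _).
  apply: ler_sum => z _; apply: le_trans (ler_normB _ _) _.
  by rewrite !ger0_norm ?walk_ge0.
by rewrite big_split /= !sum_walk; lra.
Qed.

(** After the coupled first step, the difference of the two laws is a [pi]-mean of differences at
    time n; the triangle inequality does the rest. *)
Lemma tv_coupling n x y pi : coupling (P x) (P y) pi ->
  tv n.+1 x y <= \sum_u \sum_v pi u v * tv n u v.
Proof.
move=> [pi0 pi1 pi2].
have -> : \sum_u \sum_v pi u v * tv n u v =
    2^-1 * \sum_z \sum_u \sum_v pi u v * `|walk n u z - walk n v z|.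
  transitivity (\sum_u \sum_v \sum_z
      2^-1 * (pi u v * `|walk n u z - walk n v z|)).
    apply: eq_bigr => u _; apply: eq_bigr => v _.
    by rewrite /tv mulrCA !mulr_sumr.
  under eq_bigr do rewrite exchange_big /=.
  rewrite exchange_big mulr_sumr; apply: eq_bigr => z _ /=.
  by rewrite mulr_sumr; apply: eq_bigr => u _; rewrite mulr_sumr.
rewrite ler_wpM2l ?invr_ge0 //; apply: ler_sum => z _.
have -> : walk n.+1 x z - walk n.+1 y z =
    \sum_u \sum_v pi u v * (walk n u z - walk n v z).
  rewrite /walk /=.
  under eq_bigr do rewrite -pi1 mulr_suml.
  under [X in _ - X]eq_bigr do rewrite -pi2 mulr_suml.
  rewrite [X in _ - X]exchange_big -sumrB; apply: eq_bigr => u _ /=.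
  by rewrite -sumrB; apply: eq_bigr => v _; rewrite mulrBr.
apply: le_trans (ler_norm_sum _ _ _) _; apply: ler_sum => u _.
apply: le_trans (ler_norm_sum _ _ _) _; apply: ler_sum => v _.
by rewrite normrM ger0_norm.
Qed.

(* The tangent at k to a convex function, with the gap at the points j < k:
   this gap is the gain when the distance drops. *)
Lemma half_exp_convex (j k : nat) :
  2^-1 ^+ k - 2^-1 ^+ k.+1 * (j%:R - k%:R) + 2^-1 ^+ k.+1 * (j < k)%:R
    <= 2^-1 ^+ j :> R.
Proof.
(* Dividing by 2^-j or 2^-k leaves one variable i: [two_exp] serves k = j + i + 1, and [half_exp]
   serves j = k + i. *)
have two_exp (i : nat) : i%:R + 4 <= 2 * 2 ^+ i.+1 :> R.
  elim: i => [|i IH]; first by rewrite expr1; lra.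
  by rewrite exprS -natr1; have := ler0n R i; move: IH; lra.
have half_exp (i : nat) : 2 - i%:R <= 2 * 2^-1 ^+ i :> R.
  have half_ge0 l : 0 <= 2^-1 ^+ l :> R by rewrite exprn_ge0 ?invr_ge0.
  case: i => [|[|i]]; rewrite ?expr0 ?expr1; try lra.
  by have := half_ge0 i.+2; have := ler0n R i; rewrite -!natr1; lra.
have p0 l : 0 < 2^-1 ^+ l :> R by rewrite exprn_gt0 ?invr_gt0.
rewrite [2^-1 ^+ k.+1]exprS; case: ltnP => [jk|/subnKC <-].
  have [i ->] : exists i, k = (j + i.+1)%N.
    by exists (k - j.+1)%N; rewrite -addSnnS subnKC.
  have e : 2^-1 ^+ i.+1 * 2 ^+ i.+1 = 1 :> R
    by rewrite -exprMn mulVf ?pnatr_eq0 // expr1n.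
  rewrite natrD -(natr1 i) exprD; move: (two_exp i) (p0 j) (p0 i.+1) e.
  set X := 2^-1 ^+ i.+1; set Y := 2 ^+ i.+1; set Z := 2^-1 ^+ j => Yi Z0 X0 e.
  have : X * (i%:R + 4) <= 2 by have := ler_wpM2l (ltW X0) Yi; lra.
  by move/(ler_wpM2l (ltW Z0)); rewrite mulr1n; lra.
set i := (j - k)%N; rewrite exprD natrD.
by have := ler_wpM2l (ltW (p0 k)) (half_exp i); rewrite mulr0n; lra.
Qed.

(* Each step costs at most 1 as long as x != y.  This is paid by the drop of
   C (1 - 2^-d) if d < K and deg x <= D, by d / K if d >= K, and by h x if
   deg x > D; the error coming from eps is absorbed in e.  In one step d grows
   by at most 2 and r decreases by 1, so gdist x y + 3 n <= r keeps all the
   geodesics involved away from A. *)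
Lemma sum_tv_le (A : {set G}) (h : G -> R) (D K r0 : nat) (eps C e : R) :
  (0 < K)%N -> 0 <= eps ->
  (forall u v, adj u v -> u \notin A ->
    exists2 pi, coupling (P u) (P v) pi & cost pi <= 1 + eps) ->
  (forall x, 0 <= h x) -> (forall x, (D < deg x)%N -> 1 <= h x) ->
  C = 2 ^+ K.+2 * D%:R -> (C + (r0 * r0)%:R) * eps <= e ->
  forall n r x y, x \notin nbhd A r -> connect (@adj G) x y ->
  (gdist x y + 3 * n <= r)%N -> (r <= r0)%N ->
  \sum_(t < n) tv t x y <= C * (1 - 2^-1 ^+ gdist x y)
    + \sum_(t < n) evol t h x + n%:R * ((gdist x y)%:R / K%:R) + n%:R * e.
Proof.
move=> K0 eps0 hA h0 hD CE he.
have C0 : 0 <= C by rewrite CE mulr_ge0 ?ler0n // exprn_ge0.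
have e0 : 0 <= e by apply: le_trans he; rewrite mulr_ge0 // addr_ge0 ?ler0n.
have half_le1 k : 2^-1 ^+ k <= 1 :> R.
  by rewrite exprn_ile1 // ?invr_ge0 //; lra.
have half_ge0 k : 0 <= 2^-1 ^+ k :> R by rewrite exprn_ge0 ?invr_ge0.
have KV0 : 0 < (K%:R)^-1 :> R by rewrite invr_gt0 ltr0n.
elim=> [|n IH] r x y xr xy dr rr0.
  by rewrite !big_ord0 !mul0r !addr0 mulr_ge0 // subr_ge0.
have rhs0 m z : 0 <= \sum_(t < m) evol t h z.
  by apply: sumr_ge0 => t _; exact: evol_ge0.
have [->|nxy] := eqVneq x y.
  rewrite big1; last by move=> t _; rewrite tvxx.
  by rewrite gdistxx mul0r mulr0 !addr_ge0 ?mulr_ge0 ?subr_ge0 ?ler0n.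
have dr' : (gdist x y <= r)%N by apply: leq_trans dr; rewrite leq_addr.
have [pi [a [c l da dx Ea]]] := contraction_step eps0 hA xr xy nxy dr'.
have [pi0 pi1 pi2] := c.
set d := gdist x y in l da dr dr' *.
(* Expectation under [pi]; by [Ele], comparisons are needed only on pairs charged by [pi]. *)
pose E (f : G -> G -> R) := \sum_u \sum_v pi u v * f u v.
have EE f g : (forall u v, f u v = g u v) -> E f = E g.
  by move=> fg; rewrite /E; under eq_bigr do under eq_bigr do rewrite fg.
have ED f g : E (fun u v => f u v + g u v) = E f + E g.
  rewrite /E -big_split; apply: eq_bigr => u _ /=.
  by rewrite -big_split; apply: eq_bigr => v _ /=; rewrite mulrDr.
have EZ k f : E (fun u v => k * f u v) = k * E f.
  rewrite /E mulr_sumr; apply: eq_bigr => u _.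
  by rewrite mulr_sumr; apply: eq_bigr => v _; rewrite mulrCA.
have E1 k : E (fun _ _ => k) = k.
  rewrite -[k in LHS]mulr1 EZ /E.
  under eq_bigr do under eq_bigr do rewrite mulr1.
  by rewrite (coupling_mass c (sum_lazy_walk R x)) mulr1.
have Ele f g : (forall u v, pi u v != 0 -> f u v <= g u v) -> E f <= E g.
  move=> fg; apply: ler_sum => u _; apply: ler_sum => v _.
  have [->|n0] := eqVneq (pi u v) 0; first by rewrite !mul0r.
  by rewrite ler_wpM2l // fg.
have Eh : E (fun u _ => \sum_(t < n) evol t h u) = \sum_(t < n) evol t.+1 h x.
  rewrite /= exchange_big /E /=; apply: eq_bigr => u _.
  by rewrite -mulr_suml pi1 mulr_sumr.
pose Ed := E (fun u v => (gdist u v)%:R).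
have lEd : Ed <= d%:R * (1 + eps) by [].
(* The mean of [half_exp_convex] with k = d; the distance drops with probability at least
   [pi a y]. *)
have drop : E (fun u v => 2^-1 ^+ gdist u v) >=
    2^-1 ^+ d - 2^-1 ^+ d.+1 * (Ed - d%:R)
      + 2^-1 ^+ d.+1 * (2 * (deg x)%:R)^-1.
  have := Ele _ _ (fun u v _ => half_exp_convex (gdist u v) d).
  rewrite ED EZ [X in X + _]ED E1.
  rewrite (EE _ (fun u v => - 2^-1 ^+ d.+1 * (gdist u v)%:R
    + 2^-1 ^+ d.+1 * d%:R)); last by move=> u v; ring.
  rewrite ED EZ E1 -/Ed (_ : - _ * Ed + _ = - (2^-1 ^+ d.+1 * (Ed - d%:R)));
    last by ring.
  apply: le_trans; rewrite lerD2l ler_wpM2l // -Ea /E.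
  rewrite (bigD1 a) //= (bigD1 y) //= da mulr1 -addrA lerDl.
  rewrite addr_ge0 ?sumr_ge0 // => u _; last apply: sumr_ge0 => v _;
    by rewrite mulr_ge0.
(* The term t = 0 is at most 1; the later ones are bounded through the coupled first step. *)
have rec : \sum_(t < n.+1) tv t x y <= 1 + E (fun u v => \sum_(t < n) tv t u v).
  rewrite big_ord_recl lerD ?tv_le1 //.
  have -> : E (fun u v => \sum_(t < n) tv t u v) = \sum_(t < n) E (tv t).
    rewrite /E [RHS]exchange_big; apply: eq_bigr => u _ /=.
    by rewrite exchange_big; apply: eq_bigr => v _ /=; rewrite mulr_sumr.
  by apply: ler_sum => t _; exact: tv_coupling.
have {rec}rec := le_trans rec (_ : _ <= 1 + E (fun u v =>
  C * (1 - 2^-1 ^+ gdist u v) + \sum_(t < n) evol t h u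
    + n%:R * ((gdist u v)%:R / K%:R) + n%:R * e)).
apply: le_trans (rec _) _ => {rec}.
  rewrite lerD2l; apply: Ele => u v n0; have [xu yv] := coupling_neq0 c n0.
  have {}xu := lazy_walk_support xu; have {}yv := lazy_walk_support yv.
  (* The case r = 0 is excluded by [dr], which demands room for n + 1 steps. *)
  case: r xr rr0 dr dr' => [|r'] xr rr0 dr dr'.
    by move: dr; rewrite mulnS addnCA leqNgt.
  have ux : connect (@adj G) u x.
    rewrite (sym_connect_sym (@adj_sym G)).
    by case/orP: xu => [/eqP->|/connect1].
  have yv' : connect (@adj G) y v by case/orP: yv => [/eqP->|/connect1].
  apply: (IH r'); first exact: notin_nbhdS xr xu.
  - exact: connect_trans (connect_trans ux xy) yv'.
  - have dux : (gdist u x <= 1)%N.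
      by rewrite gdistC; case/orP: xu => [/eqP->|/gdist_adj]; rewrite ?gdistxx.
    have dyv : (gdist y v <= 1)%N.
      by case/orP: yv => [/eqP->|/gdist_adj]; rewrite ?gdistxx.
    have := gdist_triangle u x v; have := gdist_triangle x y v.
    by rewrite -/d; move: dux dyv dr; clear; lia.
  - exact: ltnW.
rewrite (EE _ (fun u v => (C + n%:R * e) + (- C * 2^-1 ^+ gdist u v +
  (\sum_(t < n) evol t h u + n%:R / K%:R * (gdist u v)%:R)))); last first.
  by move=> u v; ring.
rewrite ED E1 ED EZ ED EZ Eh -/Ed big_ord_recl.
rewrite (_ : \sum_(i < n) evol (lift ord0 i) h x =
  \sum_(i < n) evol i.+1 h x) //.
set H := \sum_(i < n) evol i.+1 h x.
rewrite [evol ord0 h x]/=.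
(* C is chosen for this: if d < K and deg x <= D, then [2 ^+ d.+1 * (2 * deg x)] is at most
   [2 ^+ K.+2 * D]. *)
have one_le : 1 <= h x + d%:R / K%:R + C * (2^-1 ^+ d.+1 * (2 * (deg x)%:R)^-1).
  have hx0 := h0 x.
  have dK0 : 0 <= d%:R / K%:R :> R by rewrite divr_ge0 ?ler0n.
  have t0 : 0 <= C * (2^-1 ^+ d.+1 * (2 * (deg x)%:R)^-1).
    by rewrite !mulr_ge0 // invr_ge0 mulr_ge0 ?ler0n.
  have [dD|Dd] := leqP (deg x) D; last by have := hD _ Dd; lra.
  have [dK|Kd] := ltnP d K; last first.
    have : 1 <= d%:R / K%:R :> R; last by lra.
    by rewrite ler_pdivlMr ?ltr0n // mul1r ler_nat.
  have : 1 <= C * (2^-1 ^+ d.+1 * (2 * (deg x)%:R)^-1); last by lra.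
  rewrite CE exprVn -invfM ler_pdivlMr ?mul1r; last first.
    by rewrite !mulr_gt0 ?exprn_gt0 ?ltr0n.
  rewrite mulrA -exprSr ler_pM ?ler_nat ?exprn_ge0 ?ler0n //.
  by apply: ler_weXn2l; [rewrite ler1n | rewrite !ltnS ltnW].
(* This keeps the curvature error in the potential below [C * eps], whatever d is. *)
have d_le : 2^-1 ^+ d.+1 * d%:R <= 1 :> R.
  rewrite exprVn mulrC ler_pdivrMr ?exprn_gt0 ?ltr0n // mul1r -natrX ler_nat.
  exact: leq_trans (ltnW (ltn_expl d (ltnSn 1))) (leq_pexp2l _ (leqnSn d)).
have Edd : Ed - d%:R <= d%:R * eps by move: lEd; rewrite mulrDr mulr1; lra.
have t1 : C * (2^-1 ^+ d.+1 * (Ed - d%:R)) <= C * eps.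
  rewrite ler_wpM2l //; apply: le_trans (_ : 2^-1 ^+ d.+1 * (d%:R * eps) <= _).
    by rewrite ler_wpM2l.
  by rewrite mulrA ler_piMl.
(* Both n and d are at most r0, since d + 3 (n + 1) <= r <= r0. *)
have t2 : n%:R / K%:R * (Ed - d%:R) <= (r0 * r0)%:R * eps.
  apply: le_trans (_ : n%:R / K%:R * (d%:R * eps) <= _).
    by rewrite ler_wpM2l // divr_ge0 ?ler0n.
  rewrite mulrA ler_wpM2r // mulrAC natrM.
  apply: le_trans (_ : n%:R * d%:R <= _).
    rewrite ler_piMr ?mulr_ge0 ?ler0n // invf_le1 ?ltr0n //.
    by rewrite ler1n.
  by rewrite -!natrM ler_nat leq_mul //; move: dr rr0 dr'; clear; lia.
have {}drop := ler_wpM2l C0 drop.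
rewrite -(natr1 n).
move: one_le drop t1 t2 he e0; move: (E _) (K%:R^-1) => ep KV.
by clear; lra.
Qed.

End Contraction.

(** * Uniform integrability of the degrees *)

Section Mass.
Variable R : realType.
Implicit Type G : sgraph.

Definition deg_entropy G : R := \sum_(x : G) (deg x)%:R * ln (deg x)%:R.

Lemma degM_ln_ge0 (d : nat) : 0 <= d%:R * ln d%:R :> R.
Proof.
case: d => [|d]; first by rewrite mul0r.
by rewrite mulr_ge0 ?ler0n // ln_ge0 // ler1n.
Qed.

(** Markov's inequality with weight [ln (deg x)], which is at least L once deg x > exp L. The
    summand 1 in L keeps it positive when C0 = 0. *)
Lemma high_degree_mass (C0 eta : R) : 0 <= C0 -> 0 < eta ->
  exists D, forall G, deg_entropy G <= C0 * #|G|%:R ->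
    \sum_(x : G | (D < deg x)%N) mass R x <= eta * #|G|%:R.
Proof.
move=> C0_ge0 eta0; pose L := (C0 + 1) / eta.
have L0 : 0 < L by rewrite divr_gt0 // ltr_wpDl.
exists (Num.bound (expR L)) => G hG.
have /archi_boundP := expR_ge0 L; set D := Num.bound _ => LD.
have : L * (\sum_(x : G | (D < deg x)%N) mass R x) <= C0 * #|G|%:R.
  apply: le_trans hG; rewrite mulr_sumr /deg_entropy big_mkcond.
  apply: ler_sum => x _; case: ltnP => [Dx|_]; last exact: degM_ln_ge0.
  have dx : (0 < deg x)%N by apply: leq_trans Dx.
  rewrite /mass (maxn_idPr _) // mulrC ler_wpM2l ?ler0n //.
  rewrite -[L]expRK ler_ln ?posrE ?expR_gt0 ?ltr0n //.
  by apply/ltW/(lt_trans LD); rewrite ltr_nat.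
rewrite -ler_pdivlMl // => /le_trans; apply.
by rewrite mulrA ler_wpM2r ?ler0n // ler_pdivrMl // /L mulfVK ?gt_eqF //; lra.
Qed.

(** Vertices of bounded degree have bounded mass each; the others are covered by
    [high_degree_mass]. *)
Lemma set_mass_le (C0 eta : R) : 0 <= C0 -> 0 < eta ->
  exists D : nat, forall G (A : {set G}), deg_entropy G <= C0 * #|G|%:R ->
    \sum_(x in A) mass R x <= D%:R * #|A|%:R + eta * #|G|%:R.
Proof.
move=> C0_ge0 eta0; have [D hD] := high_degree_mass C0_ge0 eta0.
exists D.+1 => G A hG.
rewrite (bigID (fun x => (D < deg x)%N)) /= addrC lerD //; last first.
  apply: le_trans (hD G hG); rewrite big_mkcondl; apply: ler_sum => x _.
  by case: ifP => // _; rewrite ltW ?mass_gt0.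
apply: le_trans (_ : \sum_(x in A) D.+1%:R <= _).
  rewrite big_mkcondr; apply: ler_sum => x _; case: ltnP => [_|dx] /=.
    exact: ler0n.
  by rewrite ler_nat geq_max /= (leq_trans dx).
by rewrite sumr_const mulr_natr.
Qed.

Lemma total_mass_le (C0 : R) : 0 <= C0 ->
  exists2 C1 : R, 0 < C1 & forall G, deg_entropy G <= C0 * #|G|%:R ->
    \sum_(x : G) mass R x <= C1 * #|G|%:R.
Proof.
move=> C0_ge0; have [D hD] := set_mass_le C0_ge0 ltr01.
exists (D%:R + 1) => [|G hG]; first by rewrite ltr_wpDl ?ler0n.
have := hD G [set: G] hG; rewrite cardsT mulrDl.
by under eq_bigl do rewrite inE.
Qed.

Lemma sum_adj G (y : G) : \sum_(x : G) (adj x y)%:R = (deg y)%:R :> R.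
Proof.
rewrite /deg -sum1_card natr_sum [RHS]big_mkcond; apply: eq_bigr => x _.
by rewrite inE adj_sym; case: adj.
Qed.

(** Each y of the smaller neighbourhood accounts for itself and its neighbours, and [1 + deg y] is
    at most [2 * mass R y]. *)
Lemma card_nbhdS G (A : {set G}) r :
  #|nbhd A r.+1|%:R <= 2 * \sum_(y in nbhd A r) mass R y.
Proof.
have : #|nbhd A r.+1|%:R <=
    \sum_(x : G) \sum_(y in nbhd A r) ((x == y)%:R + (adj x y)%:R) :> R.
  rewrite -sum1_card natr_sum big_mkcond; apply: ler_sum => x _.
  rewrite (fun_if (fun z : R => z <= _)).
  have t0 y : 0 <= (x == y)%:R + (adj x y)%:R :> R by rewrite addr_ge0 ?ler0n.
  case: ifP => [|_]; last by apply: sumr_ge0.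
  rewrite inE => /orP[xr|/existsP[y /andP[yr xy]]].
    rewrite (bigD1 x) //= eqxx adj_irr addr0 lerDl.
    by apply: sumr_ge0.
  rewrite (bigD1 y) //= xy; apply: le_trans (_ : (x == y)%:R + 1 <= _).
    by rewrite lerDr ler0n.
  by rewrite lerDl; apply: sumr_ge0.
move/le_trans; apply; rewrite exchange_big mulr_sumr; apply: ler_sum => y _ /=.
rewrite big_split /= sum_adj (bigD1 y) //= eqxx big1 ?addr0; last first.
  by move=> x /negPf->.
by rewrite mulr_natl mulr2n lerD ?mass_ge1 // ler_nat leq_maxr.
Qed.

(** Two bounds alternate along r: small mass of one neighbourhood gives small cardinality of the
    next, hence small mass again. *)
Lemma nbhd_mass_le (C0 : R) r (eta : R) : 0 <= C0 -> 0 < eta ->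
  exists2 a : R, 0 < a & forall G (A : {set G}),
    deg_entropy G <= C0 * #|G|%:R -> #|A|%:R <= a * #|G|%:R ->
    \sum_(x in nbhd A r) mass R x <= eta * #|G|%:R.
Proof.
move=> C0_ge0; elim: r eta => [|r IH] eta eta0.
  have [|D hD] := @set_mass_le C0 (eta / 2) C0_ge0; first by rewrite divr_gt0.
  exists (eta / 2 / D.+1%:R) => [|G A hG hA]; first by rewrite !divr_gt0.
  apply: le_trans (hD G A hG) _.
  have hA' : D%:R * #|A|%:R <= eta / 2 * #|G|%:R.
    apply: le_trans (_ : D.+1%:R * #|A|%:R <= _).
      by rewrite ler_wpM2r ?ler_nat.
    apply: le_trans (ler_wpM2l (ler0n _ _) hA) _.
    by rewrite mulrA (mulrC D.+1%:R) mulfVK ?pnatr_eq0.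
  by rewrite -[X in _ <= X]/(eta * _); lra.
have [|D hD] := @set_mass_le C0 (eta / 2) C0_ge0; first by rewrite divr_gt0.
(* The 4 absorbs the factor 2 of [card_nbhdS] and leaves half of eta for the high degrees. *)
have [|a a0 ha] := IH (eta / 4 / D.+1%:R); first by rewrite !divr_gt0.
exists a => // G A hG hA.
apply: le_trans (hD G _ hG) _.
have hA' : D%:R * #|nbhd A r.+1|%:R <= eta / 2 * #|G|%:R.
  apply: le_trans (_ : D.+1%:R * #|nbhd A r.+1|%:R <= _).
    by rewrite ler_wpM2r ?ler_nat.
  apply: le_trans (ler_wpM2l (ler0n _ _) (card_nbhdS A r)) _.
  have := ler_wpM2l (ler0n R D.+1) (ha G A hG hA).
  rewrite mulrA [_ * (_ / _)]mulrC mulfVK ?pnatr_eq0 //.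
  by move=> h; lra.
by lra.
Qed.

Lemma degree_bound_ge0 (Delta : R) : 1 <= Delta -> 0 <= Delta * ln Delta.
Proof. by move=> D1; rewrite mulr_ge0 ?ln_ge0 // (le_trans ler01). Qed.

End Mass.

(** * Spectral theorem for real symmetric matrices in real coordinates *)

Section Spectral.
Variable R : rcfType.

Lemma mulcJ (z : R[i]) :
  z * z^* = real_complex R (complex.Re z ^+ 2 + complex.Im z ^+ 2).
Proof.
case: z => a b; apply/eqP; rewrite eq_complex /=.
by apply/andP; split; apply/eqP; ring.
Qed.

Lemma sum_real_complex (I : finType) (f : I -> R) (z : I -> R[i]) :
  \sum_i real_complex R (f i) * z i =
  ((\sum_i f i * complex.Re (z i)) +i* (\sum_i f i * complex.Im (z i)))%C.
Proof.
elim: (index_enum I) => [|i r IH]; first by rewrite !big_nil.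
rewrite !big_cons IH; case: (z i) => a b.
by apply/eqP; rewrite eq_complex /=; apply/andP; split; apply/eqP; ring.
Qed.

(* X and Y are the real and imaginary parts of a unitary diagonalising A. *)
Lemma sym_spectral n (A : 'M[R]_n) : A^T = A ->
  exists (s : 'I_n -> R) (X Y : 'M[R]_n),
  [/\ char_poly A = \prod_i ('X - (s i)%:P),
      forall f : 'I_n -> R, \sum_x f x ^+ 2 =
        \sum_i ((\sum_x f x * X i x) ^+ 2 + (\sum_x f x * Y i x) ^+ 2),
      forall f : 'I_n -> R, \sum_x \sum_y f x * f y * A x y =
        \sum_i s i * ((\sum_x f x * X i x) ^+ 2 + (\sum_x f x * Y i x) ^+ 2) &
      forall i, \sum_x (X i x ^+ 2 + Y i x ^+ 2) = 1].
Proof.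
move=> At; pose C := R[i]; pose c : {rmorphism R -> R[i]} := real_complex R.
pose B : 'M[C]_n := map_mx c A.
have Breal : B \is a realmx.
  by apply/mxOverP => i j; rewrite mxE; apply/complex_realP; exists (A i j).
have Bherm : B \is hermsymmx.
  apply: realsym_hermsym => //; apply/is_hermitianmxP.
  by rewrite expr0 scale1r map_mx_id // /B map_trmx At.
have /orthomx_spectralP Beq := hermitian_normalmx Bherm.
have /mxOverP dreal := hermitian_spectral_diag_real Bherm.
have Uu := spectral_unit B; have UU := spectral_unitarymx B.
have UV := invmx_unitary UU.
set U := spectralmx B in Beq Uu UU UV; set d := spectral_diag B in Beq dreal.
pose s i := complex.Re (d 0 i).
have dE i : d 0 i = c (s i).
  by rewrite /s; have /complex_realP[k ->] := dreal 0 i.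
pose X : 'M[R]_n := \matrix_(i, j) complex.Re (U i j).
pose Y : 'M[R]_n := \matrix_(i, j) complex.Im (U i j).
(* The form is the sum of e_i |p_i|^2, where p_i pairs f with row i of U. Weights 1 give the norm
   identity, weights s the form of A. *)
have quad (e : 'rV[R]_n) (f : 'I_n -> R) (F := \row_x c (f x)) :
    (F *m (invmx U *m diag_mx (map_mx c e) *m U) *m F^T) 0 0 =
    c (\sum_i e 0 i * ((\sum_x f x * X i x) ^+ 2 + (\sum_x f x * Y i x) ^+ 2)).
  rewrite UV !mulmxA -[_ *m U *m _]mulmxA mul_mx_diag mxE rmorph_sum.
  apply: eq_bigr => i _; rewrite !mxE rmorphM /=.
  pose p := \sum_x c (f x) * U i x.
  have -> : \sum_j F 0 j * (U ^t*)%sesqui j i = p^*.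
    rewrite /p rmorph_sum; apply: eq_bigr => x _; rewrite !mxE rmorphM.
    by congr (_ * _); rewrite -[RHS]/(conjc _) conjc_real.
  have -> : \sum_j U i j * F^T j 0 = p.
    by apply: eq_bigr => x _; rewrite !mxE mulrC.
  rewrite mulrAC mulrC [_^* * p]mulrC mulcJ /p sum_real_complex /=.
  congr (_ * c (_ ^+ 2 + _ ^+ 2)); apply: eq_bigr => x _; by rewrite mxE.
exists s, X, Y; split.
- apply: (map_poly_inj c); rewrite map_char_poly -/B Beq.
  rewrite -{2}[U]invmxK char_poly_conj ?unitmx_inv //.
  rewrite char_poly_trig ?diag_mx_is_trig // rmorph_prod; apply: eq_bigr => i _.
  by rewrite mxE eqxx mulr1n rmorphB /= map_polyX map_polyC dE.
- move=> f; apply: (@complexI R).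
  have /= := quad (const_mx 1) f; rewrite map_const_mx rmorph1 diag_const_mx.
  rewrite mulmx1 mulVmx // mulmx1.
  under [X in _ = c X -> _]eq_bigr do rewrite mxE mul1r.
  move=> <-; rewrite mxE rmorph_sum; apply: eq_bigr => x _.
  by rewrite !mxE -rmorphM.
- move=> f; apply: (@complexI R).
  have /= := quad (\row_i s i) f.
  under [X in _ = c X -> _]eq_bigr do rewrite mxE.
  move=> <-; have -> : map_mx c (\row_i s i) = d.
    by apply/rowP => i; rewrite !mxE dE.
  rewrite -Beq mxE exchange_big rmorph_sum; apply: eq_bigr => y _ /=.
  rewrite rmorph_sum !mxE mulr_suml; apply: eq_bigr => x _.
  by rewrite !mxE -!rmorphM; congr (real_complex R _); ring.
- move=> i; apply: (@complexI R).
  have /unitarymxP/matrixP/(_ i i) := UU; rewrite !mxE eqxx => E.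
  apply: (etrans _ E); rewrite (rmorph_sum c); apply: eq_bigr => x _.
  by rewrite !mxE mulcJ.
Qed.

End Spectral.

(** * The symmetrised walk and the count of large eigenvalues *)

Section GraphSpectral.
Variables (R : realType) (G : sgraph).
Local Notation P := (@lazy_walk G R).
Implicit Types x y : G.

Definition root_mass x : R := Num.sqrt (mass R x).

Lemma root_mass_gt0 x : 0 < root_mass x.
Proof. by rewrite sqrtr_gt0 mass_gt0. Qed.

Lemma sqr_root_mass x : root_mass x ^+ 2 = mass R x.
Proof. by rewrite sqr_sqrtr // ltW ?mass_gt0. Qed.

(** The walk conjugated by the diagonal matrix of [root_mass]: symmetric by reversibility, with the
    same characteristic polynomial. *)
Definition sym_walk x y : R := root_mass x * P x y / root_mass y.

Lemma sym_walkC x y : sym_walk x y = sym_walk y x.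
Proof.
have := lazy_walk_reversible R x y; rewrite -!sqr_root_mass /sym_walk.
have := gt_eqF (root_mass_gt0 x); have := gt_eqF (root_mass_gt0 y).
move=> /negbT wy /negbT wx E.
apply: (mulfI wx); apply: (mulfI wy).
transitivity (root_mass x ^+ 2 * P x y); first by field.
by rewrite E; field.
Qed.

(** The difference is a Dirichlet form: half the sum of [P x y] times a square. *)
Lemma sym_walk_form_le (f : G -> R) :
  \sum_x \sum_y f x * f y * sym_walk x y <= \sum_x f x ^+ 2.
Proof.
have E : \sum_x f x ^+ 2 =
    \sum_x \sum_y 2^-1 * (f x ^+ 2 * P x y + f y ^+ 2 * P y x).
  have E1 : \sum_x f x ^+ 2 = \sum_x \sum_y f x ^+ 2 * P x y.
    by apply: eq_bigr => x _; rewrite -mulr_sumr sum_lazy_walk mulr1.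
  under [RHS]eq_bigr do rewrite -mulr_sumr big_split.
  rewrite -mulr_sumr big_split /= [X in _ + X]exchange_big /= -E1; lra.
rewrite E; apply: ler_sum => x _; apply: ler_sum => y _; rewrite -subr_ge0.
have wy := gt_eqF (root_mass_gt0 y); have wx := gt_eqF (root_mass_gt0 x).
have -> : P y x = P x y * root_mass x ^+ 2 / root_mass y ^+ 2.
  have := lazy_walk_reversible R x y; rewrite -!sqr_root_mass => Exy.
  by rewrite [P x y * _]mulrC Exy mulrAC mulfV ?mul1r // sqrf_eq0 wy.
have -> : 2^-1 * (f x ^+ 2 * P x y + f y ^+ 2 *
    (P x y * root_mass x ^+ 2 / root_mass y ^+ 2)) - f x * f y * sym_walk x y =
    2^-1 * (P x y * (f x - f y * root_mass x / root_mass y) ^+ 2).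
  by rewrite /sym_walk; field; rewrite wy.
by rewrite mulr_ge0 ?invr_ge0 ?ler0n // mulr_ge0 ?lazy_walk_ge0 ?sqr_ge0.
Qed.

Lemma sum_enum_val (f : G -> R) : \sum_x f x = \sum_(i < #|G|) f (enum_val i).
Proof.
rewrite (reindex (@enum_val G G)) //; apply: onW_bij; exact: enum_val_bij.
Qed.

Lemma card_eigval (s : 'I_#|G| -> R) rho :
  char_poly (transition_mx G R) = \prod_i ('X - (s i)%:P) ->
  #|[set i | rho < s i]| = #|[set i : 'I_#|G| | rho < eigval R i]|.
Proof.
move=> sE.
have sE' : char_poly (transition_mx G R) =
    \prod_(a <- [seq s i | i <- enum 'I_#|G|]) ('X - a%:P).
  by rewrite sE big_map big_enum.
have ps := eigenvalues_perm sE'.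
have -> : #|[set i | rho < s i]| =
    count (fun a => rho < a) [seq s i | i <- enum 'I_#|G|].
  by rewrite cardsE cardE count_map size_filter enumT.
rewrite -(permP ps) cardsE cardE size_filter -enumT.
have sz : size (eigenvalues (transition_mx G R)) = #|G|.
  by rewrite (perm_size ps) size_map size_enum_ord.
rewrite -[eigenvalues _ in LHS](mkseq_nth 0) sz /mkseq -val_enum_ord.
by rewrite -map_comp count_map.
Qed.

(** Expand in eigenvectors. Eigenvalues up to rho contribute at most rho times their share of the
    norm. Each other one is at most 1 and carries total weight at most L, by the Gram bound tested
    on the real and imaginary parts of a unit eigenvector. *)
Lemma eigval_form_le (J : finType) (F : J -> G -> R) (rho L : R) :
  0 <= rho ->
  (forall v : G -> R,
    \sum_j (\sum_x F j x * v x) ^+ 2 <= L * \sum_x v x ^+ 2) ->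
  \sum_j \sum_x \sum_y F j x * F j y * sym_walk x y <=
  rho * (\sum_j \sum_x F j x ^+ 2)
    + L * #|[set i : 'I_#|G| | rho < eigval R i]|%:R.
Proof.
move=> rho0 hF.
pose S : 'M[R]_#|G| := \matrix_(i, j) sym_walk (enum_val i) (enum_val j).
have ST : S^T = S by apply/matrixP => i j; rewrite !mxE sym_walkC.
pose D := diag_mx (\row_(i < #|G|) root_mass (enum_val i)).
pose D' := diag_mx (\row_(i < #|G|) (root_mass (enum_val i))^-1).
have DD' : D *m D' = 1%:M.
  rewrite mulmx_diag -diag_const_mx; congr diag_mx.
  by apply/rowP => i; rewrite !mxE divff // gt_eqF ?root_mass_gt0.
have [Du _] := mulmx1_unit DD'.
have D'E : D' = invmx D.
  by rewrite -[D']mul1mx -(mulVmx Du) -mulmxA DD' mulmx1.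
have SE : S = D *m transition_mx G R *m invmx D.
  rewrite -D'E; apply/matrixP => i j.
  by rewrite mul_mx_diag mul_diag_mx !mxE.
have [s [X [Y [sE norm form unit]]]] := sym_spectral ST.
(* [sym_walk_form_le] is tested on a real eigenvector for [s i]. *)
have s1 i : s i <= 1.
  have : root (char_poly S) (s i).
    by rewrite sE rootE horner_prod (bigD1 i) //= !hornerE subrr mul0r.
  rewrite -eigenvalue_root_char => /eigenvalueP[v vS v0].
  pose f x := v 0 (enum_rank x).
  have fn : 0 < \sum_x f x ^+ 2.
    have [k vk] : exists k, v 0 k != 0 by apply/rV0Pn.
    rewrite (bigD1 (enum_val k)) //= ltr_pwDl //.
      by rewrite /f enum_valK exprn_even_gt0.
    by apply: sumr_ge0 => x _; exact: sqr_ge0.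
  rewrite -(ler_pM2r fn) mul1r; apply: le_trans (sym_walk_form_le f).
  rewrite le_eqVlt; apply/orP; left; apply/eqP.
  rewrite exchange_big !sum_enum_val mulr_sumr; apply: eq_bigr => k _ /=.
  have := congr1 (fun u : 'rV_#|G| => u 0 k) vS; rewrite !mxE => Ek.
  rewrite /f enum_valK expr2 mulrA -Ek mulr_suml sum_enum_val.
  by apply: eq_bigr => l _; rewrite mxE enum_valK; ring.
rewrite -(card_eigval (s := s)); last first.
  by rewrite -sE SE char_poly_conj.
(* Squared modulus of the coefficient of [F j] along the i-th eigenvector. *)
pose a j i : R := (\sum_k F j (enum_val k) * X i k) ^+ 2 +
                  (\sum_k F j (enum_val k) * Y i k) ^+ 2.
have -> : \sum_j \sum_x \sum_y F j x * F j y * sym_walk x y =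
    \sum_i s i * \sum_j a j i.
  under [RHS]eq_bigr do rewrite mulr_sumr.
  rewrite [RHS]exchange_big; apply: eq_bigr => j _ /=.
  rewrite -(form (fun k => F j (enum_val k))) sum_enum_val.
  apply: eq_bigr => k _; rewrite sum_enum_val; apply: eq_bigr => l _.
  by rewrite mxE.
have -> : \sum_j \sum_x F j x ^+ 2 = \sum_i \sum_j a j i.
  rewrite [RHS]exchange_big; apply: eq_bigr => j _ /=.
  by rewrite sum_enum_val (norm (fun k => F j (enum_val k))).
have a_ge0 i : 0 <= \sum_j a j i.
  by apply: sumr_ge0 => j _; rewrite addr_ge0 ?sqr_ge0.
have a_leL i : \sum_j a j i <= L.
  rewrite big_split /= -[L]mulr1 -(unit i) big_split mulrDr /=.
  have red (Z : 'M[R]_#|G|) : \sum_j (\sum_k F j (enum_val k) * Z i k) ^+ 2 <=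
      L * \sum_k Z i k ^+ 2.
    have := hF (fun x => Z i (enum_rank x)).
    rewrite [X in L * X]sum_enum_val.
    under [X in L * X]eq_bigr do rewrite enum_valK.
    apply: le_trans; rewrite le_eqVlt; apply/orP; left; apply/eqP.
    apply: eq_bigr => j _; rewrite sum_enum_val; congr (_ ^+ 2).
    by apply: eq_bigr => k _; rewrite enum_valK.
  by rewrite lerD ?red.
have -> : L * #|[set i | rho < s i]|%:R = \sum_i (if rho < s i then L else 0).
  rewrite mulr_natr -sumr_const big_mkcond.
  by apply: eq_bigr => i _; rewrite inE.
rewrite mulr_sumr -big_split; apply: ler_sum => i _ /=.
case: ltP => hs; last by rewrite addr0 ler_wpM2r.
apply: le_trans (_ : \sum_j a j i <= _); first by rewrite ler_piMl.
by apply: le_trans (a_leL i) _; rewrite lerDr mulr_ge0.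
Qed.

End GraphSpectral.

(** * Test functions: Gram bound and energy *)

Lemma sqr_sum_le (R : realFieldType) (T : finType) (W : {set T}) (a : T -> R) :
  (\sum_(x in W) a x) ^+ 2 <= #|W|%:R * \sum_(x in W) a x ^+ 2.
Proof.
have -> : #|W|%:R * \sum_(x in W) a x ^+ 2 =
    \sum_(x in W) \sum_(y in W) 2^-1 * (a x ^+ 2 + a y ^+ 2).
  have E : #|W|%:R * \sum_(x in W) a x ^+ 2 =
      \sum_(x in W) \sum_(y in W) a x ^+ 2.
    by rewrite mulr_sumr; apply: eq_bigr => x _; rewrite sumr_const mulr_natl.
  under [RHS]eq_bigr do rewrite -mulr_sumr big_split.
  by rewrite -mulr_sumr big_split /= [X in _ + X]exchange_big /= -E; lra.
rewrite expr2 mulr_suml; apply: ler_sum => x _; rewrite mulr_sumr.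
apply: ler_sum => y _; rewrite -subr_ge0.
have -> : 2^-1 * (a x ^+ 2 + a y ^+ 2) - a x * a y = 2^-1 * (a x - a y) ^+ 2.
  by field.
by rewrite mulr_ge0 ?invr_ge0 ?ler0n ?sqr_ge0.
Qed.

Section Energy.
Variables (R : realType) (G : sgraph).
Local Notation P := (@lazy_walk G R).
Implicit Types x y z : G.

Lemma notin_nbhd (A : {set G}) r x : x \notin nbhd A r -> x \notin A.
Proof.
by move=> xr; have := notin_nbhd_path (p := [::]) xr isT isT; rewrite /= andbT.
Qed.

(** Starting points are counted backwards from z: the points on the way lie off A, so each has at
    most D + 1 predecessors, itself included. *)
Lemma card_walk_support (A : {set G}) (D : nat) :
  (forall x, x \notin A -> (deg x <= D)%N) ->
  forall t r z, (t <= r)%N ->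
  (#|[set x | (x \notin nbhd A r) && (walk R t x z != 0%R)]| <= D.+1 ^ t)%N.
Proof.
move=> hD; elim=> [|t IH] r z.
  move=> _; rewrite expn0 -(cards1 z); apply: subset_leq_card.
  apply/fintype.subsetP => x; rewrite !inE /walk /= => /andP[_].
  by case: (x == z) => //; rewrite eqxx.
case: r => // r tr; rewrite expnS.
set N := [set x | _].
pose M := [set x | (x \notin nbhd A r) && (walk R t x z != 0%R)].
have sub : N \subset \bigcup_(w in M) (w |: [set x | adj w x]).
  apply/fintype.subsetP => x; rewrite inE => /andP[xr].
  case: (pselect (exists w, P x w != 0 /\ walk R t w z != 0)) => [|none].
    case=> w [Pw ww] _; have xw := lazy_walk_support Pw.
    apply/bigcupP; exists w; first by rewrite inE ww andbT (notin_nbhdS xr xw).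
    by rewrite !inE adj_sym.
  rewrite /walk /= big1 ?eqxx // => w _; apply/eqP; rewrite mulf_eq0.
  apply/negPn/negP; rewrite negb_or => /andP[w1 w2].
  by apply: none; exists w.
apply: leq_trans (subset_leq_card sub) _.
apply: leq_trans (_ : \sum_(w in M) D.+1 <= _)%N; last first.
  by rewrite sum_nat_const mulnC leq_mul2l IH.
elim/big_rec2: _ => [|w n B]; first by rewrite cards0.
rewrite inE => /andP[/notin_nbhd/hD dw _] IHB.
apply: leq_trans (leq_card_setU _ _) _; rewrite leq_add // cardsU1.
by rewrite -add1n leq_add // leq_b1.
Qed.

Lemma stationary (h : G -> R) t :
  \sum_x mass R x * evol t h x = \sum_x mass R x * h x.
Proof.
elim: t => //= t IH; rewrite -IH.
under eq_bigr do rewrite mulr_sumr.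
rewrite exchange_big; apply: eq_bigr => w _ /=.
under eq_bigr do rewrite mulrA lazy_walk_reversible mulrAC.
by rewrite -mulr_sumr sum_lazy_walk mulr1.
Qed.

(** [1 - tv] is the overlap of the two laws, the sum over z of min(p, q), and min(p, q) is at most
    the geometric mean. *)
Lemma bhattacharyya_ge t x y :
  1 - tv R t x y <= \sum_z Num.sqrt (walk R t x z) * Num.sqrt (walk R t y z).
Proof.
have -> : 1 - tv R t x y = \sum_z 2^-1 * (walk R t x z + walk R t y z -
    `|walk R t x z - walk R t y z|).
  by rewrite -mulr_sumr sumrB big_split /= !sum_walk /tv; lra.
apply: ler_sum => z _; have := walk_ge0 R t x z; have := walk_ge0 R t y z.
move: (walk R t x z) (walk R t y z) => p q q0 p0.
wlog pq : p q p0 q0 / p <= q.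
  case: (leP p q) => [|/ltW] pq h; first exact: h.
  by rewrite [Num.sqrt p * _]mulrC distrC (addrC p); exact: h.
rewrite distrC ger0_norm ?subr_ge0 //.
apply: le_trans (_ : Num.sqrt p * Num.sqrt p <= _).
  by rewrite -expr2 sqr_sqrtr //; lra.
by rewrite ler_wpM2l ?sqrtr_ge0 // ler_sqrt.
Qed.

(** The square root turns overlaps of laws into inner products over z, while the squares still sum
    to the mass of x. *)
Definition test_fun (W : {set G}) t z x : R :=
  if x \in W then root_mass R x * Num.sqrt (walk R t x z) else 0.

Lemma test_fun_ge0 W t z x : 0 <= test_fun W t z x.
Proof.
by rewrite /test_fun; case: ifP => // _; rewrite mulr_ge0 ?sqrtr_ge0.
Qed.

Lemma test_fun_norm W t x :
  \sum_z test_fun W t z x ^+ 2 = if x \in W then mass R x else 0.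
Proof.
rewrite /test_fun; case: ifP => _; last first.
  by rewrite big1 // => z _; rewrite expr0n.
rewrite -[RHS]mulr1 -(sum_walk R t x) mulr_sumr; apply: eq_bigr => z _.
by rewrite exprMn sqr_root_mass sqr_sqrtr ?walk_ge0.
Qed.

Lemma test_fun_form_ge (W : {set G}) t x y : x \in W -> y \in W ->
  mass R x * P x y * (1 - tv R t x y) <=
  \sum_z test_fun W t z x * test_fun W t z y * sym_walk R x y.
Proof.
move=> xW yW; rewrite /test_fun xW yW.
have wy := gt_eqF (root_mass_gt0 R y).
have -> : \sum_z root_mass R x * Num.sqrt (walk R t x z) *
    (root_mass R y * Num.sqrt (walk R t y z)) * sym_walk R x y =
    mass R x * P x y * \sum_z Num.sqrt (walk R t x z) * Num.sqrt (walk R t y z).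
  rewrite mulr_sumr; apply: eq_bigr => z _; rewrite /sym_walk -sqr_root_mass.
  by field; rewrite wy.
by rewrite ler_wpM2l ?bhattacharyya_ge ?mulr_ge0 ?lazy_walk_ge0 ?ltW ?mass_gt0.
Qed.

(** Cauchy-Schwarz on each support costs the factor [D.+1 ^ S]. The squares then sum over z to a
    mass of at most [D.+1], for each of S times. *)
Lemma test_fun_gram (A : {set G}) (D S r : nat) (v : G -> R) :
  (forall x, x \notin A -> (deg x <= D)%N) -> (S <= r)%N ->
  \sum_(j : 'I_S * G) (\sum_x test_fun (~: nbhd A r) j.1 j.2 x * v x) ^+ 2 <=
  (D.+1 ^ S * (S * D.+1))%:R * \sum_x v x ^+ 2.
Proof.
move=> hD Sr; set W := ~: nbhd A r; set B := (D.+1 ^ S)%N.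
have one (t : 'I_S) z : (\sum_x test_fun W t z x * v x) ^+ 2 <=
    B%:R * \sum_x test_fun W t z x ^+ 2 * v x ^+ 2.
  pose N := [set x | (x \notin nbhd A r) && (walk R t x z != 0%R)].
  have out x : x \notin N -> test_fun W t z x = 0.
    rewrite /test_fun inE [x \in W]inE; case: (x \in nbhd A r) => //=.
    by rewrite negbK => /eqP->; rewrite sqrtr0 mulr0.
  have sumN (g : G -> R) : (forall x, x \notin N -> g x = 0) ->
      \sum_x g x = \sum_(x in N) g x.
    move=> g0; rewrite [RHS]big_mkcond; apply: eq_bigr => x _.
    by case: ifP => // /negbT/g0.
  rewrite sumN; last by move=> x /out->; rewrite mul0r.
  apply: le_trans (sqr_sum_le _ _) _.
  rewrite [X in _ <= _ * X]sumN; last by move=> x /out->; rewrite expr0n mul0r.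
  under eq_bigr do rewrite exprMn.
  apply: ler_wpM2r; first by apply: sumr_ge0 => x _; rewrite mulr_ge0 ?sqr_ge0.
  rewrite ler_nat; apply: leq_trans (card_walk_support hD z _) _.
    by apply: leq_trans Sr; exact: ltnW.
  by rewrite leq_pexp2l // ltnW.
apply: le_trans (ler_sum _ (fun j _ => one j.1 j.2)) _.
rewrite -mulr_sumr natrM -mulrA ler_wpM2l ?ler0n //.
rewrite exchange_big mulr_sumr; apply: ler_sum => x _ /=.
rewrite -mulr_suml ler_wpM2r ?sqr_ge0 //.
rewrite -(pair_big xpredT xpredT
  (fun (t : 'I_S) z => test_fun W t z x ^+ 2)) /=.
under eq_bigr do rewrite test_fun_norm.
rewrite sumr_const card_ord -[_ *+ S]mulr_natl natrM ler_wpM2l ?ler0n //.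
rewrite inE; case: (boolP (x \in nbhd A r)) => [_|/notin_nbhd/hD dx] /=.
  exact: ler0n.
by rewrite ler_nat geq_max /= (leq_trans dx).
Qed.

(** The stationary flow loses what starts outside W and what ends there; by reversibility these two
    amounts are equal. *)
Lemma sum_in_in_ge (W : {set G}) :
  \sum_(x : G) mass R x - 2 * \sum_(x in ~: W) mass R x <=
  \sum_(x in W) \sum_(y in W) mass R x * P x y.
Proof.
have full : \sum_(x : G) mass R x = \sum_x \sum_y mass R x * P x y.
  by apply: eq_bigr => x _; rewrite -mulr_sumr sum_lazy_walk mulr1.
have outl : \sum_(x in ~: W) mass R x =
    \sum_(x in ~: W) \sum_y mass R x * P x y.
  by apply: eq_bigr => x _; rewrite -mulr_sumr sum_lazy_walk mulr1.
have outr : \sum_(x in ~: W) mass R x =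
    \sum_x \sum_(y in ~: W) mass R x * P x y.
  rewrite outl [RHS]exchange_big; apply: eq_bigr => x _; apply: eq_bigr => y _.
  exact: lazy_walk_reversible.
have fourth : \sum_(x in W) \sum_y mass R x * P x y <=
    \sum_(x in W) \sum_(y in W) mass R x * P x y
    + \sum_x \sum_(y in ~: W) mass R x * P x y.
  rewrite [X in X + _]big_mkcond [X in X <= _]big_mkcond -big_split.
  apply: ler_sum => x _ /=.
  have t0 y : 0 <= mass R x * P x y.
    by rewrite mulr_ge0 ?lazy_walk_ge0 // ltW ?mass_gt0.
  case: ifP => _; last by rewrite add0r sumr_ge0.
  rewrite [X in X <= _](bigID (mem W)) /= lerD2l le_eqVlt; apply/orP; left.
  by apply/eqP; apply: eq_bigl => y; rewrite inE.
have split : \sum_x \sum_y mass R x * P x y =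
    \sum_(x in W) \sum_y mass R x * P x y
    + \sum_(x in ~: W) \sum_y mass R x * P x y.
  rewrite (bigID (mem W)) /=; congr (_ + _).
  by apply: eq_bigl => y; rewrite inE.
by rewrite full split -outl; move: fourth; rewrite -outr; lra.
Qed.

(** Inside W the form at time t is at least [mass R x * P x y * (1 - tv R t x y)]; summing over t
    turns the last factor into at least [S - b x]. *)
Lemma energy_ge (W : {set G}) (S : nat) (b : G -> R) :
  (forall x, 0 <= b x) ->
  (forall x y, x \in W -> P x y != 0 -> \sum_(t < S) tv R t x y <= b x) ->
  S%:R * (\sum_(x : G) mass R x - 2 * \sum_(x in ~: W) mass R x)
    - \sum_x mass R x * b x <=
  \sum_(j : 'I_S * G) \sum_x \sum_y
    test_fun W j.1 j.2 x * test_fun W j.1 j.2 y * sym_walk R x y.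
Proof.
move=> b0 hb.
have mP0 x y : 0 <= mass R x * P x y.
  by rewrite mulr_ge0 ?lazy_walk_ge0 // ltW ?mass_gt0.
have -> : \sum_(j : 'I_S * G) \sum_x \sum_y
    test_fun W j.1 j.2 x * test_fun W j.1 j.2 y * sym_walk R x y =
    \sum_(x in W) \sum_(y in W) \sum_(t < S) \sum_z
      test_fun W t z x * test_fun W t z y * sym_walk R x y.
  rewrite exchange_big [RHS]big_mkcond; apply: eq_bigr => x _ /=.
  rewrite exchange_big /=; case: ifP => [_|xW]; last first.
    rewrite big1 // => y _; rewrite big1 // => j _.
    by rewrite /test_fun xW !mul0r.
  rewrite [RHS]big_mkcond; apply: eq_bigr => y _ /=.
  case: ifP => [_|yW]; last first.
    by rewrite big1 // => j _; rewrite /test_fun yW mulr0 mul0r.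
  by rewrite (pair_big xpredT xpredT (fun (t : 'I_S) z =>
    test_fun W t z x * test_fun W t z y * sym_walk R x y)).
apply: le_trans (_ : \sum_(x in W) \sum_(y in W)
    mass R x * P x y * (S%:R - b x) <= _); last first.
  apply: ler_sum => x xW; apply: ler_sum => y yW.
  (* Without a transition [hb] gives no bound, but then the left side is 0 and the right side
     nonnegative. *)
  have [->|Pxy] := eqVneq (P x y) 0.
    rewrite mulr0 mul0r; apply: sumr_ge0 => t _; apply: sumr_ge0 => z _.
    rewrite !mulr_ge0 ?test_fun_ge0 ?invr_ge0 ?lazy_walk_ge0 //;
      by rewrite ltW ?root_mass_gt0.
  apply: le_trans (_ : \sum_(t < S) mass R x * P x y * (1 - tv R t x y) <= _).
    rewrite -mulr_sumr ler_wpM2l // sumrB sumr_const card_ord lerD2l lerN2.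
    exact: hb.
  by apply: ler_sum => t _; exact: test_fun_form_ge.
have -> : \sum_(x in W) \sum_(y in W) mass R x * P x y * (S%:R - b x) =
    S%:R * (\sum_(x in W) \sum_(y in W) mass R x * P x y)
    - \sum_(x in W) (\sum_(y in W) mass R x * P x y) * b x.
  rewrite mulr_sumr -sumrB; apply: eq_bigr => x _.
  by rewrite -mulr_suml mulrBr [S%:R * _]mulrC.
apply: lerB; first by rewrite ler_wpM2l ?ler0n ?sum_in_in_ge.
rewrite big_mkcond; apply: ler_sum => x _; case: ifP => _; last first.
  by rewrite mulr_ge0 // ltW ?mass_gt0.
rewrite ler_wpM2r // -[X in _ <= X]mulr1 -(sum_lazy_walk R x) mulr_sumr.
by rewrite big_mkcond; apply: ler_sum => y _; case: ifP.
Qed.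

Lemma card_edges_le : #|edges G|%:R <= \sum_(x : G) mass R x.
Proof.
apply: le_trans (_ : #|[set p : G * G | adj p.1 p.2]|%:R <= _).
  by rewrite ler_nat leq_imset_card.
rewrite -sum1_card natr_sum big_mkcond.
rewrite (eq_bigr (fun p : G * G => (adj p.1 p.2)%:R)); last first.
  by move=> p _; rewrite inE; case: adj.
rewrite -(pair_big xpredT xpredT (fun x y => (adj x y)%:R)) /=.
apply: ler_sum => x _; under eq_bigr do rewrite adj_sym.
by rewrite sum_adj ler_nat leq_maxr.
Qed.

Definition curved_ends (eps : R) : {set G} :=
  [set x | [exists y, adj x y && (curvature R x y < - eps)]].

Lemma card_curved_ends eps :
  (#|curved_ends eps| <= 2 * #|edges_curv_lt G (- eps)|)%N.
Proof.
have sub : curved_ends eps \subset finset.cover (edges_curv_lt G (- eps)).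
  apply/fintype.subsetP => x; rewrite inE => /existsP[y xy].
  apply/bigcupP; exists [set x; y]; last by rewrite !inE eqxx.
  by apply/imsetP; exists (x, y); rewrite ?inE.
apply: leq_trans (subset_leq_card sub) _.
apply: leq_trans (leq_card_cover _) _.
rewrite mulnC -sum_nat_const; apply: leq_sum => e /imsetP[p _ ->].
by rewrite cards2; case: eqP.
Qed.

End Energy.

(** * Choice of the constants and conclusion *)

Unset Implicit Arguments.

Theorem theorem2 (R : realType) (Delta rho : R)
    (hDelta : 1 <= Delta) (hrho0 : 0 < rho) (hrho1 : rho < 1) :
  exists2 eps : R, 0 < eps & forall G : sgraph,
    [\/ Delta * ln Delta * #|G|%:R < \sum_(x : G) (deg x)%:R * ln (deg x)%:R,
        eps * #|G|%:R <= #|[set i : 'I_#|G| | rho < eigval R i]|%:R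
      | eps * #|edges G|%:R <= #|edges_curv_lt G (- eps)|%:R].
Proof.
pose C0 := Delta * ln Delta.
have C0_ge0 : 0 <= C0 := degree_bound_ge0 hDelta.
(* The losses below must stay under the gap theta. Each constant is chosen from the earlier ones,
   before any graph is given, so eps depends only on Delta and rho. *)
pose theta := 1 - rho; have th0 : 0 < theta by rewrite subr_gt0.
have th8 : 0 < theta / 8 by rewrite divr_gt0.
pose K := (Num.bound (8 / theta)).+1.
have hK : K%:R^-1 <= theta / 8.
  have /archi_boundP : 0 <= 8 / theta by rewrite ltW // divr_gt0.
  move=> h; have K0 : 0 < K%:R :> R by rewrite ltr0n.
  rewrite -[theta / 8]invrK lef_pV2 ?posrE ?invr_gt0 // invf_div.
  by apply/ltW/(lt_le_trans h); rewrite ler_nat.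
have [D hD] := high_degree_mass C0_ge0 th8.
pose C : R := 2 ^+ K.+2 * D%:R.
have C_ge0 : 0 <= C by rewrite mulr_ge0 ?ler0n // exprn_ge0.
(* The potential, bounded by C, becomes negligible when averaged over S times. *)
pose S := (Num.bound (C / (theta / 8))).+1.
have hS : C <= S%:R * (theta / 8).
  have /archi_boundP : 0 <= C / (theta / 8) by rewrite divr_ge0 // ltW.
  rewrite -ler_pdivrMr // => /ltW/le_trans; apply.
  by rewrite ler_nat.
have S0 : 0 < S%:R :> R by rewrite ltr0n.
(* Initial distance at most 1, plus 3 for each of the S steps. *)
pose r0 := (3 * S).+1.
pose eps1 := theta / 8 / (C + (r0 * r0)%:R).
have Cr0 : 0 < C + (r0 * r0)%:R by rewrite ltr_wpDl // ltr0n.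
have eps1_gt0 : 0 < eps1 by rewrite divr_gt0.
have [|a a0 ha] := @nbhd_mass_le R C0 r0 (theta / 16) C0_ge0.
  by rewrite divr_gt0.
have [|D2 hD2] := @high_degree_mass R C0 (a / 2) C0_ge0.
  by rewrite divr_gt0.
have [C1 C1_gt0 hC1] := total_mass_le C0_ge0.
pose L : R := (D2.+1 ^ S * (S * D2.+1))%:R.
have L0 : 0 < L by rewrite ltr0n muln_gt0 expn_gt0.
(* The three bounds serve the couplings at good vertices, the number of ends of curved edges, and
   the number of eigenvalues above rho. *)
pose eps :=
  Num.min (eps1 / 2) (Num.min (a / (4 * C1)) (S%:R * (theta / 8) / L)).
have eps_gt0 : 0 < eps.
  rewrite !lt_min; apply/and3P; split; first exact: divr_gt0.
    by apply: divr_gt0 => //; exact: mulr_gt0.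
  by apply: divr_gt0 => //; exact: mulr_gt0.
have eps_le1 : eps <= eps1 / 2 by rewrite ge_min lexx.
have eps_le2 : eps <= a / (4 * C1) by rewrite !ge_min lexx orbT.
have eps_le3 : eps <= S%:R * (theta / 8) / L by rewrite !ge_min lexx !orbT.
exists eps => // G.
have [c1|hE] := ltP (Delta * ln Delta * #|G|%:R)
  (\sum_(x : G) (deg x)%:R * ln (deg x)%:R); first by constructor 1.
have [c2|hl] := leP (eps * #|G|%:R) #|[set i : 'I_#|G| | rho < eigval R i]|%:R.
  by constructor 2.
have [c3|hc] := leP (eps * #|edges G|%:R) #|edges_curv_lt G (- eps)|%:R.
  by constructor 3.
exfalso.
have hG : deg_entropy R G <= C0 * #|G|%:R by [].
(* Failure of (ii) excludes the empty graph. *)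
have N0 : 0 < #|G|%:R :> R.
  by rewrite -(pmulr_rgt0 _ eps_gt0); apply: le_lt_trans hl; rewrite ler0n.
set N : R := #|G|%:R in hG N0 hl *.
set m := \sum_(x : G) mass R x.
have m_geN : N <= m.
  by rewrite /N -sum1_card natr_sum; apply: ler_sum => x _; exact: mass_ge1.
have m_leN : m <= C1 * N by exact: hC1.
pose A := [set x : G | (D2 < deg x)%N] :|: curved_ends G eps.
have cardA : #|A|%:R <= a * N.
  apply: le_trans (_ : (#|[set x : G | (D2 < deg x)%N]| +
    #|curved_ends G eps|)%:R <= _).
    by rewrite ler_nat leq_card_setU.
  have h1 : #|[set x : G | (D2 < deg x)%N]|%:R <= a / 2 * N.
    apply: le_trans (hD2 G hG); rewrite -sum1_card natr_sum.
    under eq_bigl do rewrite inE.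
    by apply: ler_sum => x _; exact: mass_ge1.
  have h2 : #|curved_ends G eps|%:R <= a / 2 * N.
    have := card_curved_ends G eps; rewrite -(ler_nat R) natrM.
    move/le_trans; apply.
    apply: le_trans (_ : 2 * (eps * (C1 * N)) <= _).
      rewrite ler_wpM2l // (le_trans (ltW hc)) // ler_wpM2l ?(ltW eps_gt0) //.
      exact: le_trans (card_edges_le R G) m_leN.
    have := ler_wpM2r (ltW (mulr_gt0 C1_gt0 N0)) eps_le2.
    have -> : a / (4 * C1) * (C1 * N) = a / 4 * N by field; rewrite gt_eqF.
    by lra.
  by rewrite natrD; lra.
pose W := ~: nbhd A r0.
have mnbhd : \sum_(x in ~: W) mass R x <= theta / 16 * N.
  by rewrite /W finset.setCK; exact: ha.
pose h (x : G) : R := (D < deg x)%:R.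
have h0 x : 0 <= h x by exact: ler0n.
have mh : \sum_x mass R x * h x <= theta / 8 * N.
  apply: le_trans (hD G hG); rewrite [X in _ <= X]big_mkcond.
  by apply: ler_sum => x _; rewrite /h; case: ltnP; rewrite ?mulr1 ?mulr0.
have hdeg x : x \notin A -> (deg x <= D2)%N.
  by rewrite !inE negb_or -leqNgt => /andP[].
have hA (u v : G) : adj u v -> u \notin A ->
    exists2 pi, coupling (lazy_walk R u) (lazy_walk R v) pi
      & cost pi <= 1 + eps1.
  move=> uv; rewrite !inE negb_or => /andP[_ /existsPn/(_ v)].
  rewrite uv /= -leNgt => cuv.
  (* [curvature_coupling] doubles its parameter, hence [eps1 / 2]. *)
  have [||pi cp l] := @curvature_coupling R G (eps1 / 2) u v.
  - by rewrite divr_gt0.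
  - by apply: le_trans cuv; rewrite lerN2.
  - by exists pi => //; apply: le_trans l _; lra.
(* The bound of [sum_tv_le] at distance at most 1: potential, visits to high degrees, 1 / K term,
   curvature error. *)
pose b x :=
  C + \sum_(t < S) evol t h x + S%:R * (theta / 8) + S%:R * (theta / 8).
have b0 x : 0 <= b x.
  have St : 0 <= S%:R * (theta / 8) by rewrite mulr_ge0 // ltW.
  have evol0 : 0 <= \sum_(t < S) evol t h x.
    by apply: sumr_ge0 => t _; exact: evol_ge0.
  by rewrite /b; lra.
have hb x y : x \in W -> lazy_walk R x y != 0 -> \sum_(t < S) tv R t x y <= b x.
  rewrite inE => xW /lazy_walk_support xy.
  have dxy : (gdist x y <= 1)%N.
    by case/orP: xy => [/eqP->|/gdist_adj]; rewrite ?gdistxx.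
  have cxy : connect (@adj G) x y by case/orP: xy => [/eqP->|/connect1].
  have dr : (gdist x y + 3 * S <= r0)%N.
    by rewrite /r0 -(add1n (3 * S)) leq_add2r.
  have := @sum_tv_le R G A h D K r0 eps1 C (theta / 8) isT (ltW eps1_gt0)
    hA h0 _ _ _ S r0 x y xW cxy dr (leqnn _).
  move=> H; apply: le_trans (H _ _ _) _ => {H}.
  - by move=> z Dz; rewrite /h Dz.
  - by [].
  - by rewrite /eps1 mulrC mulfVK ?gt_eqF.
  rewrite lerD2r lerD ?lerD2r //.
    rewrite ler_piMr // lerBlDr lerDl exprn_ge0 ?invr_ge0 //.
  rewrite ler_wpM2l ?(ltW S0) //; apply: le_trans hK.
  by rewrite ler_piMl ?invr_ge0 ?ler0n // lern1.
have Sr0 : (S <= r0)%N by rewrite /r0 leqW // leq_pmull.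
have lower := energy_ge b0 hb.
have upper := eigval_form_le (F := fun j : 'I_S * G => test_fun R W j.1 j.2)
  (ltW hrho0) (fun v => test_fun_gram v hdeg Sr0).
have norm : \sum_(j : 'I_S * G) \sum_x test_fun R W j.1 j.2 x ^+ 2 <= S%:R * m.
  rewrite exchange_big mulr_sumr; apply: ler_sum => x _ /=.
  rewrite -(pair_big xpredT xpredT
    (fun (t : 'I_S) z => test_fun R W t z x ^+ 2)) /=.
  under eq_bigr do rewrite test_fun_norm.
  rewrite sumr_const card_ord -[_ *+ S]mulr_natl ler_wpM2l ?ler0n //.
  by case: ifP => // _; rewrite ltW ?mass_gt0.
have {}upper := le_trans lower upper.
(* By stationarity, the visits to high degrees cost S times the mass of these vertices. *)
have mb : \sum_x mass R x * b x =
    m * (C + S%:R * (theta / 8) + S%:R * (theta / 8)) +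
    S%:R * (\sum_x mass R x * h x).
  transitivity (\sum_x (mass R x * (C + S%:R * (theta / 8) + S%:R * (theta / 8))
      + \sum_(t < S) mass R x * evol t h x)).
    by apply: eq_bigr => x _; rewrite -mulr_sumr /b; ring.
  rewrite big_split -mulr_suml exchange_big; congr (_ + _).
  under eq_bigr do rewrite stationary.
  by rewrite sumr_const card_ord mulr_natl.
have {}norm := ler_wpM2l (ltW hrho0) norm.
have Ll : L * #|[set i : 'I_#|G| | rho < eigval R i]|%:R <=
    S%:R * (theta / 8) * N.
  apply: le_trans (ler_wpM2l (ltW L0) (ltW hl)) _.
  rewrite (mulrA L) ler_wpM2r ?(ltW N0) // mulrC.
  by rewrite -ler_pdivlMr.
have Cm := ler_wpM2r (le_trans (ltW N0) m_geN) hS.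
have mnbhd' := ler_wpM2l (ltW S0) mnbhd.
have mh' := ler_wpM2l (ltW S0) mh.
have mN := ler_wpM2l (mulr_ge0 (ltW S0) (ltW th0)) m_geN.
have pos : 0 < S%:R * theta * N by rewrite !mulr_gt0.
(* In units of S theta, the losses are at most 3/8 m from [b] without its visits and three times N/8
   from high degrees, bad vertices and large eigenvalues. Since N <= m, they stay below 3/4 m,
   whereas the inequality demands m. *)
have := le_trans upper (lerD norm Ll).
have -> : rho * (S%:R * m) = S%:R * m - S%:R * theta * m.
  by rewrite /theta; ring.
rewrite mb -/m.
move: (\sum_(x in ~: W) mass R x) mnbhd' => mB mnbhd'.
move: (\sum_x mass R x * h x) mh' => mH mh'.
move: mN mh' mnbhd' Cm pos; clearbody N m C theta; lra.
Qed.
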